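(* Consider an electrical circuit satisfying the soundness and passivity assumptions, with incidence matrices $A_C,A_R,A_L,A_V,A_I$, charge function $q$, flux function $\phi$, conductance function $g$ and sources $\imath(t),v(t)$. (1) The differentiation index $\nu$ of the DAE $$\frac{d}{dt}\begin{pmatrix}A_C&0&0&0\\0&I&0&0\\0&0&0&0\\0&0&0&0\end{pmatrix}\begin{pmatrix}q_C\\ \phi_L\\ e\\ \jmath_V\end{pmatrix}=\begin{pmatrix}0&-A_L&0&-A_V\\ A_L^\top&0&0&0\\0&0&0&0\\ A_V^\top&0&0&0\end{pmatrix}\begin{pmatrix}e\\ \phi^{-1}(\phi_L)\\ q^{-1}(q_C)\\ \jmath_V\end{pmatrix}-\begin{pmatrix}A_Rg(A_R^\top e)\\0\\ A_C^\top e-q^{-1}(q_C)\\0\end{pmatrix}+\begin{pmatrix}-A_I&0\\0&0\\0&0\\0&-I\end{pmatrix}\begin{pmatrix}\imath(t)\\ v(t)\end{pmatrix}$$ in the unknown $(q_C,\phi_L,e,\jmath_V)$ satisfies $\nu=1$ if, and only if, the circuit contains neither cycles consisting only of edges to capacitances and voltage sources (with both types present) nor cuts consisting only of edges to inductances and/or current sources. Otherwise, $\nu=2$. (2) The differentiation index $\nu$ of the DAE $$\frac{d}{dt}\begin{pmatrix}0&0&0&0&0\\0&0&0&0&0\\0&0&I&0&0\\0&0&0&I&0\\0&0&0&0&0\end{pmatrix}\begin{pmatrix}e\\ \jmath_C\\ q_C\\ \phi_L\\ \jmath_V\end{pmatrix}=\begin{pmatrix}0&-A_C&0&-A_L&-A_V\\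 A_C^\top&0&-I&0&0\\0&I&0&0&0\\ A_L^\top&0&0&0&0\\ A_V^\top&0&0&0&0\end{pmatrix}\begin{pmatrix}e\\ \jmath_C\\ q^{-1}(q_C)\\ \phi^{-1}(\phi_L)\\ \jmath_V\end{pmatrix}-\begin{pmatrix}A_Rg(A_R^\top e)\\0\\0\\0\\0\end{pmatrix}+\begin{pmatrix}-A_I&0\\0&0\\0&0\\0&0\\0&-I\end{pmatrix}\begin{pmatrix}\imath(t)\\ v(t)\end{pmatrix}$$ in the unknown $(e,\jmath_C,q_C,\phi_L,\jmath_V)$ satisfies $\nu=1$ if, and only if, the circuit contains neither cycles consisting only of edges to capacitances and/or voltage sources nor cuts consisting only of edges to inductances and/or current sources. Otherwise, $\nu=2$.
   Context: Circuit. The circuit is a finite loop-free directed graph $\mathcal G$ with vertex set $V_{\mathcal G}$, edge set $E_{\mathcal G}$ and maps $\mathrm{init},\mathrm{ter}:E_{\mathcal G}\to V_{\mathcal G}$ giving the initial and terminal vertex of each edge; its edges are capacitances, resistances, inductances, voltage sources and current sources ($n_C,n_R,n_L,n_V,n_I$ many). The all-vertex incidence matrix has entry $1$ if edge $k$ starts at vertex $j$, $-1$ if it ends there, $0$ otherwise; deleting the row of one (grounded) vertex and sorting columns by component type gives $(A_C\,A_R\,A_L\,A_I\,A_V)$. Here $e$ are the vertex potentials, $q_C$ the charges at the capacitances, $\phi_L$ the fluxes at the inductances, $\jmath_C,\jmath_V$ the currents through capacitances and voltage sources. Paths, cycles, cuts. For each edge $e$ an additional reversed edge $-e$ is introduced,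 with $\mathrm{init}(-e)=\mathrm{ter}(e)$ and $\mathrm{ter}(-e)=\mathrm{init}(e)$. An $r$-tuple $(e_1,\dots,e_r)\in(E_{\mathcal G}\cup -E_{\mathcal G})^r$ is a path from $v$ to $w$ if the initial vertices $\mathrm{init}(e_1),\dots,\mathrm{init}(e_r)$ are distinct, $\mathrm{ter}(e_i)=\mathrm{init}(e_{i+1})$ for $i=1,\dots,r-1$, $\mathrm{init}(e_1)=v$ and $\mathrm{ter}(e_r)=w$. A cycle is a path from $v$ to $v$. Two vertices are connected if there is a path from one to the other; the subgraphs induced on the equivalence classes of connected vertices are the components, and a graph is connected if it has only one component. A spanning subgraph $\mathcal K$ (all vertices, edge set $E'\subset E_{\mathcal G}$) is a cut of $\mathcal G$ if the graph with all vertices and edge set $E_{\mathcal G}\setminus E'$ has two connected components. Soundness assumption: the graph has at least one edge and is connected; it contains neither cycles consisting only of edges of voltage sources nor cuts consisting only of edges of current sources (equivalently, $A_V$ and $(A_C\,A_R\,A_L\,A_V)^\top$ have full column rank). Passivity assumption: (i) $q:\mathbb{R}^{n_C}\to\mathbb{R}^{n_C}$ and $\phi:\mathbb{R}^{n_L}\to\mathbb{R}^{n_L}$ are bijective, continuously differentiable, and their Jacobians are symmetric and positive definite everywhere; (ii) $g:\mathbb{R}^{n_R}\to\mathbb{R}^{n_R}$ is continuously differentiable and $\frac{\partial g}{\partial u_R}(u_R)+\frac{\partial g}{\partial u_R}(u_R)^\top$ is positive definite for all $u_R\in\mathbb{R}^{n_R}$. Differentiation index. Let $U,V\subset\mathbb{R}^n$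 be open, $\mathcal I\subset\mathbb{R}$ an interval, $\nu\in\mathbb{N}$, $\mathcal F:U\times V\times\mathcal I\to\mathbb{R}^k$, and consider the DAE $\mathcal F(\dot x(t),x(t),t)=0$. Its $\nu$th derivative array $\mathcal F_\nu(x^{(\nu+1)}(t),x^{(\nu)}(t),\dots,\dot x(t),x(t),t)=0$ is obtained by stacking $\mathcal F(\dot x(t),x(t),t)$ and its first $\nu$ formal derivatives with respect to time. The DAE is said to have (differentiation) index $\nu\in\mathbb{N}$ if for all $(x,t)\in V\times\mathcal I$ there exists some unique $\dot x\in U$ such that there exist some $x^{(2)},\dots,x^{(\nu+1)}\in U$ with $\mathcal F_\nu(x^{(\nu+1)},x^{(\nu)},\dots,\dot x,x,t)=0$.
   Formalization: The index is the least ν with a unique ẋ at all (x,t) where F_ν=0 is solvable (some must exist); cycles use no edge twice; the DAE is assumed solvable at some (x,t); ı, v are assumed C¹ and, for ''otherwise ν=2'', q, φ, g, ı, v are assumed C². *)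

(* Defs.v *)
From HB Require Import structures.
From mathcomp Require Import all_boot all_order all_algebra.
From mathcomp Require Import all_classical all_reals all_analysis.

Set Implicit Arguments.
Unset Strict Implicit.
Unset Printing Implicit Defensive.
Import Order.TTheory GRing.Theory Num.Theory numFieldNormedType.Exports.
Local Open Scope classical_set_scope.
Local Open Scope ring_scope.

Inductive component :=
  Capacitance | Resistance | Inductance | VoltageSource | CurrentSource.

Definition component_code (c : component) : nat :=
  match c with
  | Capacitance => 0 | Resistance => 1 | Inductance => 2
  | VoltageSource => 3 | CurrentSource => 4
  end.

Definition component_decode (n : nat) : component :=
  match n with
  | 0 => Capacitance | 1 => Resistance | 2 => Inductance
  | 3 => VoltageSource | _ => CurrentSource
  end%N.

Lemma component_codeK : cancel component_code component_decode.
Proof. by case. Qed.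

HB.instance Definition _ := Equality.copy component (can_type component_codeK).

(* Parallel edges are allowed. *)
Record circuit := Circuit {
  vertex : finType;
  edge : finType;
  init : edge -> vertex;
  ter : edge -> vertex;
  loop_free : forall a : edge, init a != ter a;
  kind : edge -> component;
  ground : vertex }.

Section Graph.
Variable G : circuit.
Implicit Types (S : {set edge G}) (v w : vertex G).

(* (a, false) is the edge a, and (a, true) is the reversed edge -a. *)
Definition oedge : Type := (edge G * bool)%type.
Definition oinit (d : oedge) : vertex G := if d.2 then ter d.1 else init d.1.
Definition oter (d : oedge) : vertex G := if d.2 then init d.1 else ter d.1.

Definition is_path S (p : seq oedge) v w : bool :=
  if p is d :: p' then
    [&& all (fun c : oedge => c.1 \in S) p, uniq (map oinit p),
        path (fun c c' => oter c == oinit c') d p',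
        oinit d == v & oter (last d p') == w]
  else false.

(* An edge is not traversed twice.  As initial vertices are distinct, this
   only excludes the degenerate closed paths (a, -a) and (-a, a), which would
   turn every edge into a cycle. *)
Definition is_cycle (p : seq oedge) : Prop :=
  uniq (map fst p) /\ exists v, is_path [set: edge G]%SET p v v.

(* A vertex is connected to itself, even if isolated in the subgraph. *)
Definition vconnected S : rel (vertex G) :=
  fun v w => `[< v = w \/ exists p, is_path S p v w >].

(* Components of the spanning subgraph with edge set S. *)
Definition components S : {set {set vertex G}} :=
  equivalence_partition (vconnected S) [set: vertex G]%SET.

Definition connected_graph : Prop := #|components [set: edge G]%SET| = 1%N.

Definition is_cut S : Prop := #|components (~: S)%SET| = 2%N.

Definition cycle_in (K : seq component) (p : seq oedge) : Prop :=
  is_cycle p /\ all (fun d : oedge => kind d.1 \in K) p.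

Definition has_cycle_in (K : seq component) : Prop := exists p, cycle_in K p.

Definition has_CV_cycle_both_types : Prop :=
  exists p, [/\ cycle_in [:: Capacitance; VoltageSource] p,
    has (fun d : oedge => kind d.1 == Capacitance) p
    & has (fun d : oedge => kind d.1 == VoltageSource) p].

Definition has_cut_in (K : seq component) : Prop :=
  exists2 S, is_cut S & forall a, a \in S -> kind a \in K.

Definition soundness : Prop :=
  [/\ (0 < #|edge G|)%N, connected_graph,
      ~ has_cycle_in [:: VoltageSource] & ~ has_cut_in [:: CurrentSource]].

Definition node_set : {set vertex G} := [set~ ground G]%SET.
Definition branch_set (c : component) : {set edge G} :=
  [set a | kind a == c]%SET.

Definition n_node : nat := #|node_set|.
Definition n_branch (c : component) : nat := #|branch_set c|.

Definition incidence_entry (R : realType) v (a : edge G) : R :=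
  if init a == v then 1 else if ter a == v then -1 else 0.

Definition incidence (R : realType) (c : component) :
    'M[R]_(n_node, n_branch c) :=
  \matrix_(i < n_node, j < n_branch c)
    incidence_entry R (enum_val i) (enum_val j).

End Graph.

Notation nC G := (n_branch G Capacitance).
Notation nR G := (n_branch G Resistance).
Notation nL G := (n_branch G Inductance).
Notation nV G := (n_branch G VoltageSource).
Notation nI G := (n_branch G CurrentSource).

Section Calculus.
Variable R : realType.

(* f is k times continuously differentiable on the open set A.  On a
   finite-dimensional V, continuity of the derivative amounts to continuity of
   all the directional derivatives. *)
Fixpoint Ck (V W : normedModType R) (k : nat) (A : set V) (f : V -> W) : Prop :=
  match k with
  | 0 => forall x, A x -> {for x, continuous f}
  | k'.+1 => (forall x, A x -> differentiable f x) /\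
             forall v : V, Ck k' A ('D_v f)
  end%N.

(* k times continuously differentiable on a neighbourhood of I. *)
Definition Ck_interval (W : normedModType R) (k : nat) (I : interval R)
    (f : R -> W) : Prop :=
  exists J : set R, [/\ open J, [set` I] `<=` J & Ck k J f].

(* The library's jacobian is for row vectors. *)
Definition jac (n m : nat) (f : 'cV[R]_n -> 'cV[R]_m) (x : 'cV[R]_n) :
    'M[R]_(m, n) :=
  \matrix_(i < m, j < n) ('D_(delta_mx j 0) f x) i 0.

Definition posdef (n : nat) (A : 'M[R]_n) : Prop :=
  forall u : 'cV[R]_n, u != 0 -> 0 < (u^T *m A *m u) 0 0.

Definition passive_storage (n : nat) (f : 'cV[R]_n -> 'cV[R]_n) : Prop :=
  [/\ bijective f, Ck 1 setT f
    & forall x, (jac f x)^T = jac f x /\ posdef (jac f x)].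

Definition passive_conductance (n : nat) (g : 'cV[R]_n -> 'cV[R]_n) : Prop :=
  Ck 1 setT g /\ forall u, posdef (jac g u + (jac g u)^T).

Definition passivity (G : circuit)
    (q : 'cV[R]_(nC G) -> 'cV[R]_(nC G)) (phi : 'cV[R]_(nL G) -> 'cV[R]_(nL G))
    (g : 'cV[R]_(nR G) -> 'cV[R]_(nR G)) : Prop :=
  [/\ passive_storage q, passive_storage phi & passive_conductance g].

End Calculus.

Section Index.
Variables (R : realType) (n k : nat).
Variables (U V : set 'cV[R]_n) (I : interval R).
Variable F : 'cV[R]_n -> 'cV[R]_n -> R -> 'cV[R]_k.
Implicit Types (y : nat -> 'cV[R]_n) (x xdot : 'cV[R]_n) (t : R).

(* y j stands for the formal variable x^(j).  By the chain rule, the formal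
   time derivative
     sum_j (dH/dx^(j)) x^(j+1) + dH/dt
   of H(x, x', x'', ..., t) is the derivative of H along the direction
   (x', x'', x''', ..., 1). *)
Definition total_derivative (H : (nat -> 'cV[R]_n) -> R -> 'cV[R]_k)
    y t : 'cV[R]_k :=
  derive1 (fun s : R => H (fun j => y j + s *: y j.+1) (t + s)) 0.

(* Block row j of the derivative array; it only depends on y 0, ..., y j.+1. *)
Definition derivative_array (j : nat) : (nat -> 'cV[R]_n) -> R -> 'cV[R]_k :=
  iter j total_derivative (fun y t => F (y 1%N) (y 0%N) t).

(* xdot in U, and there are x^(2), ..., x^(nu+1) in U for which the nu-th
   derivative array vanishes. *)
Definition array_solvable (nu : nat) xdot x t : Prop :=
  U xdot /\
  exists y, [/\ y 0%N = x, y 1%N = xdot,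
    forall j, (1 < j <= nu.+1)%N -> U (y j)
    & forall j, (j <= nu)%N -> derivative_array j y t = 0].

(* (x, t) is consistent with the nu-th derivative array. *)
Definition consistent (nu : nat) x t : Prop :=
  [/\ V x, t \in I & exists xdot, array_solvable nu xdot x t].

Definition determines_xdot (nu : nat) : Prop :=
  forall x t, consistent nu x t -> exists! xdot, array_solvable nu xdot x t.

(* A DAE with algebraic constraints admits no xdot at an inconsistent (x, t),
   so that existence and uniqueness of xdot are required at the consistent
   ones.  The index is the least order at which this holds, and the notion is
   not allowed to be vacuous. *)
Definition differentiation_index (nu : nat) : Prop :=
  [/\ exists x t, consistent nu x t,
      determines_xdot nu
    & forall mu, (mu < nu)%N -> ~ determines_xdot mu].

End Index.

Section Blocks.
Variable R : realType.

Definition row4 m a b c d (A : 'M[R]_(m, a)) (B : 'M[R]_(m, b))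
    (C : 'M[R]_(m, c)) (D : 'M[R]_(m, d)) : 'M[R]_(m, a + (b + (c + d))) :=
  row_mx A (row_mx B (row_mx C D)).

Definition row5 m a b c d e (A : 'M[R]_(m, a)) (B : 'M[R]_(m, b))
    (C : 'M[R]_(m, c)) (D : 'M[R]_(m, d)) (E : 'M[R]_(m, e)) :
    'M[R]_(m, a + (b + (c + (d + e)))) :=
  row_mx A (row4 B C D E).

Definition col4 m a b c d (A : 'M[R]_(a, m)) (B : 'M[R]_(b, m))
    (C : 'M[R]_(c, m)) (D : 'M[R]_(d, m)) : 'M[R]_(a + (b + (c + d)), m) :=
  col_mx A (col_mx B (col_mx C D)).

Definition col5 m a b c d e (A : 'M[R]_(a, m)) (B : 'M[R]_(b, m))
    (C : 'M[R]_(c, m)) (D : 'M[R]_(d, m)) (E : 'M[R]_(e, m)) :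
    'M[R]_(a + (b + (c + (d + e))), m) :=
  col_mx A (col4 B C D E).

End Blocks.

Section CircuitDAE.
Variables (R : realType) (G : circuit).
Variables (qinv : 'cV[R]_(nC G) -> 'cV[R]_(nC G))
  (phiinv : 'cV[R]_(nL G) -> 'cV[R]_(nL G))
  (g : 'cV[R]_(nR G) -> 'cV[R]_(nR G)).
Variables (isrc : R -> 'cV[R]_(nI G)) (vsrc : R -> 'cV[R]_(nV G)).

Local Notation N := (n_node G).
Local Notation A_C := (incidence G R Capacitance).
Local Notation A_R := (incidence G R Resistance).
Local Notation A_L := (incidence G R Inductance).
Local Notation A_V := (incidence G R VoltageSource).
Local Notation A_I := (incidence G R CurrentSource).

(* Both equations d/dt (E x) = M z(x) - r(x) + B s(t) are written as
   E x' - (M z(x) - r(x) + B s(t)) = 0. *)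

Definition charge_dim : nat := nC G + (nL G + (N + nV G)).
Definition charge_eqs : nat := N + (nL G + (nC G + nV G)).

(* Unknown x = (q_C, phi_L, e, j_V). *)
Definition charge_DAE (xdot x : 'cV[R]_charge_dim) (t : R) : 'cV[R]_charge_eqs :=
  let qC : 'cV_(nC G) := usubmx x in
  let phiL : 'cV_(nL G) := usubmx (dsubmx x) in
  let e : 'cV_N := usubmx (dsubmx (dsubmx x)) in
  let jV : 'cV_(nV G) := dsubmx (dsubmx (dsubmx x)) in
  let E : 'M[R]_(charge_eqs, charge_dim) :=
    col4 (row4 A_C 0     0 0)
         (row4 0   1%:M  0 0)
         (row4 0   0     0 0)
         (row4 0   0     0 0) in
  let M : 'M[R]_(charge_eqs, N + (nL G + (nC G + nV G))) :=
    col4 (row4 0      (- A_L) 0 (- A_V))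
         (row4 A_L^T  0       0 0)
         (row4 0      0       0 0)
         (row4 A_V^T  0       0 0) in
  let r : 'cV[R]_charge_eqs :=
    col4 (A_R *m g (A_R^T *m e)) 0 (A_C^T *m e - qinv qC) 0 in
  let B : 'M[R]_(charge_eqs, nI G + nV G) :=
    col4 (row_mx (- A_I) 0)
         (row_mx 0       0)
         (row_mx 0       0)
         (row_mx 0       (- 1%:M)) in
  E *m xdot
  - (M *m col4 e (phiinv phiL) (qinv qC) jV - r + B *m col_mx (isrc t) (vsrc t)).

Definition extended_dim : nat := N + (nC G + (nC G + (nL G + nV G))).

(* Unknown x = (e, j_C, q_C, phi_L, j_V). *)
Definition extended_DAE (xdot x : 'cV[R]_extended_dim) (t : R) :
    'cV[R]_extended_dim :=
  let e : 'cV_N := usubmx x in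
  let jC : 'cV_(nC G) := usubmx (dsubmx x) in
  let qC : 'cV_(nC G) := usubmx (dsubmx (dsubmx x)) in
  let phiL : 'cV_(nL G) := usubmx (dsubmx (dsubmx (dsubmx x))) in
  let jV : 'cV_(nV G) := dsubmx (dsubmx (dsubmx (dsubmx x))) in
  let E : 'M[R]_extended_dim :=
    col5 (row5 0 0 0    0    0)
         (row5 0 0 0    0    0)
         (row5 0 0 1%:M 0    0)
         (row5 0 0 0    1%:M 0)
         (row5 0 0 0    0    0) in
  let M : 'M[R]_extended_dim :=
    col5 (row5 0      (- A_C) 0        (- A_L) (- A_V))
         (row5 A_C^T  0       (- 1%:M) 0       0)
         (row5 0      1%:M    0        0       0)
         (row5 A_L^T  0       0        0       0)
         (row5 A_V^T  0       0        0       0) in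
  let r : 'cV[R]_extended_dim := col5 (A_R *m g (A_R^T *m e)) 0 0 0 0 in
  let B : 'M[R]_(extended_dim, nI G + nV G) :=
    col5 (row_mx (- A_I) 0)
         (row_mx 0       0)
         (row_mx 0       0)
         (row_mx 0       0)
         (row_mx 0       (- 1%:M)) in
  E *m xdot
  - (M *m col5 e jC (qinv qC) (phiinv phiL) jV - r
     + B *m col_mx (isrc t) (vsrc t)).

End CircuitDAE.

(* Main.v *)
Require Import Defs.
From mathcomp Require Import all_boot all_order all_algebra.
From mathcomp Require Import all_classical all_reals all_analysis.
From mathcomp Require Import ring lra.
Import Order.TTheory GRing.Theory Num.Theory numFieldNormedType.Exports.
Local Open Scope classical_set_scope.
Local Open Scope ring_scope.

(* Writing j_C for q_C', the two DAEs have the same derivative arrays: the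
   extended system only records one more derivative of the charges.

   Row k of the array is linear in the highest derivatives.  Comparing two
   solutions and testing Kirchhoff's current law against the difference de of the
   potentials, positive definiteness of the Jacobians successively gives dq' = 0
   and A_R^T de = 0; at order 1 there only remain de in the common kernel of A_C^T,
   A_R^T, A_V^T and a pair (dq'', dj_V') in the kernel of (A_C A_V), both of which
   are free.  At order 2 the next row of the array forces de = 0 through
   A_L^T de = 0, and then dq'' = 0 and dj_V' = 0.

   A point that is consistent at order 2 is obtained from one that is consistent at
   order 0 by moving only e and j_V (and j_C).  Each of the linear systems to be
   solved has a saddle-point matrix [A M A^T, X; X^T, 0] with M definite, whose
   range contains (c, 0) when c is orthogonal to the common kernel of X^T and A^T.

   The kernels are read off the graph: some circulation supported on given edges goes
   through a if and only if a lies on a cycle of such edges, and there is a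
   non-constant potential that is constant along all edges outside S if and only if
   S contains a cut.

   The inverse of a passive map f is derivable without the inverse function theorem:
   f is coercive near x by positive definiteness of its Jacobian, and monotone
   along rays from x, which makes the inverse Lipschitz at f x. *)

Set Implicit Arguments.
Unset Strict Implicit.
Unset Printing Implicit Defensive.

(** * Linear algebra *)

Section LinearAlgebra.
Variable F : fieldType.

(** The columns of [cokermx K^T] are killed by [K^T], so the hypothesis makes [b^T] vanish on all of
    them, which is membership of [b^T] in the row space of [K^T]. *)
Lemma fredholm_alternative m n (K : 'M[F]_(m, n)) (b : 'cV_m) :
  (forall u : 'cV_m, K^T *m u = 0 -> u^T *m b = 0) -> exists x, K *m x = b.
Proof.
move=> Kb; have: (b^T <= K^T)%MS.
  rewrite submxE; apply/eqP/matrixP => i j; rewrite mxE.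
  have /Kb/matrixP/(_ 0 i) : K^T *m col j (cokermx K^T) = 0.
    by rewrite colE mulmxA mulmx_coker mul0mx.
  rewrite !mxE => uv; rewrite -[RHS]uv; apply: eq_bigr => k _.
  by rewrite !mxE mulrC [i]ord1.
by case/submxP=> D /(congr1 trmx); rewrite trmxK trmx_mul trmxK => ->; exists D^T.
Qed.

(** Anisotropy of a possibly non-symmetric form. It makes sense over any field and covers the
    Jacobian of [g], of which only the symmetric part is positive. *)
Definition definite n (M : 'M[F]_n) : Prop :=
  forall u : 'cV_n, u^T *m M *m u = 0 -> u = 0.

Lemma definite_tr n (M : 'M[F]_n) : definite M -> definite M^T.
Proof.
move=> dM u; move/(congr1 trmx).
by rewrite !trmx_mul !trmxK trmx0 mulmxA => /dM.
Qed.

Lemma definite_unit n (M : 'M[F]_n) : definite M -> M \in unitmx.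
Proof.
move=> dM; rewrite -unitmx_tr -row_free_unit -kermx_eq0; apply/eqP/row_matrixP => i.
rewrite row0; apply: trmx_inj; rewrite trmx0; apply: dM.
have /(congr1 trmx) : row i (kermx M^T) *m M^T = 0.
  by rewrite -row_mul mulmx_ker row0.
by rewrite trmx_mul trmxK trmx0 -mulmxA => ->; rewrite mulmx0.
Qed.

(** The substitution [u = M *m v] turns the form of [invmx M] at [u] into the form of [M^T] at
    [v]. *)
Lemma definite_inv n (M : 'M[F]_n) : definite M -> definite (invmx M).
Proof.
move=> dM u uMu; have Mu := definite_unit dM.
suff: invmx M *m u = 0 by move/(congr1 (mulmx M)); rewrite mulKVmx // mulmx0.
by apply: (definite_tr dM); rewrite trmx_mul trmx_inv mulmxKV ?unitmx_tr // mulmxA.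
Qed.

Lemma definite_congr_eq0 n r (A : 'M[F]_(n, r)) (M : 'M[F]_r) (u : 'cV_n) :
  definite M -> u^T *m (A *m M *m A^T *m u) = 0 -> A^T *m u = 0.
Proof. by move=> dM uu; apply: dM; rewrite trmx_mul trmxK -uu !mulmxA. Qed.

(* Fredholm's alternative for the saddle-point matrix [A M A^T, X; X^T, 0]. *)
Lemma saddle_point_solvable n k r (X : 'M[F]_(n, k)) (A : 'M[F]_(n, r)) (M : 'M[F]_r)
    (c : 'cV[F]_n) :
  definite M ->
  (forall u : 'cV_n, X^T *m u = 0 -> A^T *m u = 0 -> u^T *m c = 0) ->
  exists (z : 'cV_n) (y : 'cV_k), X^T *m z = 0 /\ c = A *m M *m A^T *m z + X *m y.
Proof.
move=> dM Hc; pose K := block_mx (A *m M *m A^T) X X^T (0 : 'M[F]_k).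
have [w|x] := @fredholm_alternative _ _ K (col_mx c 0).
  rewrite -[w]vsubmxK /K tr_block_mx mul_block_col trmx0 mul0mx addr0 trmxK.
  move/eqP; rewrite col_mx_eq0 => /andP[/eqP K1 /eqP K2].
  rewrite tr_col_mx mul_row_col mulmx0 addr0 Hc //.
  apply: (definite_congr_eq0 (definite_tr dM)).
  have uX : (usubmx w)^T *m X = 0 by apply: trmx_inj; rewrite trmx_mul trmxK K2 trmx0.
  have := congr1 (mulmx (usubmx w)^T) K1.
  by rewrite mulmxDr [in X in _ + X]mulmxA uX mul0mx addr0 mulmx0 !trmx_mul trmxK !mulmxA.
rewrite -[x]vsubmxK mul_block_col mul0mx addr0 => /eq_col_mx[E1 E2].
by exists (usubmx x), (dsubmx x).
Qed.

Lemma tr_surjective n k (A : 'M[F]_(n, k)) (b : 'cV_k) :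
  (forall w : 'cV_k, A *m w = 0 -> w = 0) -> exists e, A^T *m e = b.
Proof.
move=> inj; apply: fredholm_alternative => u; rewrite trmxK => /inj ->.
by rewrite trmx0 mul0mx.
Qed.

End LinearAlgebra.

(** * The circuit equations and their derivatives *)

Section MatrixEntries.
Variables (V : zmodType) (m n : nat).
Implicit Types A B : 'M[V]_(m, n).
Lemma addmxE A B i j : (A + B) i j = A i j + B i j. Proof. by rewrite mxE. Qed.
Lemma oppmxE A i j : (- A) i j = - A i j. Proof. by rewrite mxE. Qed.
Lemma zeromxE i j : (0 : 'M[V]_(m, n)) i j = 0. Proof. by rewrite mxE. Qed.
End MatrixEntries.

Ltac mx_lra H :=
  let a := fresh in let b := fresh in let E := fresh in
  apply/matrixP => a b; have E := congr1 (fun M => fun_of_matrix M a b) H;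
  move: E; cbv beta; rewrite !(addmxE, oppmxE, zeromxE); lra.

Section CircuitEquations.
Variables (R : realType) (N nc nr nl nv : nat).
Variables (AC : 'M[R]_(N, nc)) (AR : 'M[R]_(N, nr)) (AL : 'M[R]_(N, nl))
  (AV : 'M[R]_(N, nv)).
Variables (uC : 'cV[R]_nc -> 'cV[R]_nc) (iL : 'cV[R]_nl -> 'cV[R]_nl)
  (g : 'cV[R]_nr -> 'cV[R]_nr).
Variables (DC : 'cV[R]_nc -> 'M[R]_nc) (DL : 'cV[R]_nl -> 'M[R]_nl)
  (Dg : 'cV[R]_nr -> 'M[R]_nr).
Variables (D2C : 'cV[R]_nc -> 'cV[R]_nc -> 'cV[R]_nc)
  (D2L : 'cV[R]_nl -> 'cV[R]_nl -> 'cV[R]_nl)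
  (D2g : 'cV[R]_nr -> 'cV[R]_nr -> 'cV[R]_nr).
Variables (s0 s1 s2 : 'cV[R]_N) (v0 v1 v2 : 'cV[R]_nv).
Implicit Types (q dq : 'cV[R]_nc) (p : 'cV[R]_nl) (e u de : 'cV[R]_N)
  (j dj : 'cV[R]_nv).

(* The level-k equations are the k-th formal time derivative of the circuit
   equations; q_k, p_k, e_k, j_k stand for the k-th derivatives of the charges,
   fluxes, potentials and source currents. *)
Definition level0 q0 q1 p0 p1 e0 j0 : Prop :=
  [/\ AC *m q1 + AL *m iL p0 + AV *m j0 + AR *m g (AR^T *m e0) + s0 = 0,
      p1 = AL^T *m e0, AC^T *m e0 = uC q0 & AV^T *m e0 = v0].

Definition level1 q0 q1 q2 p0 p1 p2 e0 e1 j1 : Prop :=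
  [/\ AC *m q2 + AL *m (DL p0 *m p1) + AV *m j1
        + AR *m (Dg (AR^T *m e0) *m (AR^T *m e1)) + s1 = 0,
      p2 = AL^T *m e1, AC^T *m e1 = DC q0 *m q1 & AV^T *m e1 = v1].

Definition level2 q0 q1 q2 q3 p0 p1 p2 p3 e0 e1 e2 j2 : Prop :=
  [/\ AC *m q3 + AL *m (DL p0 *m p2 + D2L p0 p1) + AV *m j2
        + AR *m (Dg (AR^T *m e0) *m (AR^T *m e2)
                 + D2g (AR^T *m e0) (AR^T *m e1)) + s2 = 0,
      p3 = AL^T *m e2, AC^T *m e2 = DC q0 *m q2 + D2C q0 q1
    & AV^T *m e2 = v2].

Hypotheses (defC : forall q, definite (DC q)) (defL : forall p, definite (DL p))
  (defg : forall x, definite (Dg x)).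
Hypothesis AV_inj : forall w : 'cV_nv, AV *m w = 0 -> w = 0.
Hypothesis CRLV_inj : forall u, AC^T *m u = 0 -> AR^T *m u = 0 ->
  AL^T *m u = 0 -> AV^T *m u = 0 -> u = 0.

Lemma tr_mul_eq0 k (A : 'M[R]_(N, k)) u : A^T *m u = 0 -> u^T *m A = 0.
Proof. by move=> Au; apply: trmx_inj; rewrite trmx_mul trmxK Au trmx0. Qed.

Lemma mulmx_tr_eq0 k (A : 'M[R]_(N, k)) (w : 'cV_k) : A *m w = 0 -> w^T *m A^T = 0.
Proof. by move=> Aw; rewrite -trmx_mul Aw trmx0. Qed.

(** Corrects charges and source currents without changing their contribution to the current law, so
    that the differentiated capacitor equation becomes solvable. Eliminating [q'] leaves a
    saddle-point system with form [invmx D], whose right-hand side lies in the range of [AC] and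
    [AV] and is thus orthogonal to the common kernel of their transposes. *)
Lemma capacitive_step (D : 'M[R]_nc) q j (b : 'cV_nc) (c : 'cV_nv) :
  definite D -> exists q' j' e',
  [/\ AC *m q' + AV *m j' = AC *m q + AV *m j, AC^T *m e' = D *m q' + b
    & AV^T *m e' = c].
Proof.
move=> dD; have Du := definite_unit dD; have [e0 e0c] := tr_surjective c AV_inj.
(* [e0] is a particular solution of the source constraint; the potential sought is [e0 + z] with
   [AV^T *m z = 0]. *)
have [u Vu Cu|z [j' [Vz E]]] := @saddle_point_solvable _ _ _ _ AV AC (invmx D)
  (AC *m q + AV *m j + AC *m (invmx D *m b) - AC *m (invmx D *m (AC^T *m e0)))
  (definite_inv dD).
  by rewrite mulmxBr !mulmxDr !mulmxA (tr_mul_eq0 Cu) (tr_mul_eq0 Vu)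
    !mul0mx subr0 !addr0.
exists (invmx D *m (AC^T *m (e0 + z) - b)), j', (e0 + z); split.
- rewrite !(mulmxDr, mulmxN) !mulmxA in E *.
  mx_lra E.
- by rewrite mulKVmx // subrK.
- by rewrite mulmxDr Vz addr0.
Qed.

Lemma resistive_step (H : 'M[R]_nr) e (c : 'cV_N) :
  definite H ->
  (forall u, AC^T *m u = 0 -> AR^T *m u = 0 -> AV^T *m u = 0 -> u^T *m c = 0) ->
  exists e' q j, [/\ AC^T *m e' = AC^T *m e, AV^T *m e' = AV^T *m e
    & AC *m q + AV *m j + AR *m (H *m (AR^T *m e')) + c = 0].
Proof.
move=> dH Hc.
have [u + Ru|z [y []]] := @saddle_point_solvable _ _ _ _ (row_mx AC AV) AR H
  (- c - AR *m (H *m (AR^T *m e))) dH.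
  rewrite tr_row_mx mul_col_mx => /eqP; rewrite col_mx_eq0.
  case/andP=> /eqP Cu /eqP Vu.
  by rewrite mulmxBr mulmxN Hc // !mulmxA (tr_mul_eq0 Ru) !mul0mx subr0 oppr0.
rewrite tr_row_mx mul_col_mx => /eqP; rewrite col_mx_eq0.
case/andP=> /eqP Cz /eqP Vz; rewrite -[y]vsubmxK mul_row_col !mulmxA => E.
exists (e + z), (usubmx y), (dsubmx y).
rewrite !mulmxDr Cz Vz !addr0 !mulmxA; split=> //.
mx_lra E.
Qed.

(** Prepares the orthogonality that [resistive_step] asks for at the next level. The potential moves
    only in the common kernel of [AC^T], [AR^T] and [AV^T]; on it [AL^T] is injective by [CRLV_inj],
    so the saddle-point system is always solvable. *)
Lemma inductive_step (M : 'M[R]_nl) e (c : 'cV_N) :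
  definite M ->
  exists e', [/\ AC^T *m e' = AC^T *m e, AR^T *m e' = AR^T *m e,
    AV^T *m e' = AV^T *m e
    & forall u, AC^T *m u = 0 -> AR^T *m u = 0 -> AV^T *m u = 0 ->
        u^T *m (AL *m (M *m (AL^T *m e')) + c) = 0].
Proof.
move=> dM.
have [u + Lu|z [y []]] := @saddle_point_solvable _ _ _ _
  (row_mx AC (row_mx AR AV)) AL M (- c - AL *m (M *m (AL^T *m e))) dM.
  rewrite !tr_row_mx !mul_col_mx => /eqP; rewrite !col_mx_eq0.
  case/and3P=> /eqP Cu /eqP Ru /eqP Vu.
  by rewrite (CRLV_inj Cu Ru Lu Vu) trmx0 mul0mx.
rewrite !tr_row_mx !mul_col_mx => /eqP; rewrite !col_mx_eq0.
case/and3P=> /eqP Cz /eqP Rz /eqP Vz E.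
exists (e + z); rewrite !mulmxDr Cz Rz Vz !addr0; split=> // u Cu Ru Vu.
rewrite !mulmxDr [u^T *m (AL *m (M *m (AL^T *m z)))](_ : _ =
  u^T *m (- c - AL *m (M *m (AL^T *m e)))).
  rewrite mulmxBr mulmxN; move: (u^T *m c) (u^T *m (AL *m _)) => X Y.
  by rewrite addrCA subrr addr0 addNr.
rewrite E mulmxDr [u^T *m (row_mx _ _ *m _)]mulmxA !mul_mx_row.
rewrite (tr_mul_eq0 Cu) (tr_mul_eq0 Ru) (tr_mul_eq0 Vu).
by rewrite !row_mx0 mul0mx addr0 !mulmxA.
Qed.

(** The uniqueness available at order 1; the freedom it leaves is the one that [level1_shift]
    adds. *)
Lemma level1_diff q0 q1 q1' q2 q2' p0 p1 p1' p2 p2' e0 e1 e1' j0 j1 j1' :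
  level0 q0 q1 p0 p1 e0 j0 -> level0 q0 q1' p0 p1' e0 j0 ->
  level1 q0 q1 q2 p0 p1 p2 e0 e1 j1 -> level1 q0 q1' q2' p0 p1' p2' e0 e1' j1' ->
  [/\ q1 = q1', p1 = p1', AC *m (q2 - q2') + AV *m (j1 - j1') = 0
    & [/\ AC^T *m (e1 - e1') = 0, AR^T *m (e1 - e1') = 0
        & AV^T *m (e1 - e1') = 0]].
Proof.
case=> F1 P1 _ _ [F1' P1' _ _] [G1 _ C1 V1] [G1' _ C1' V1'].
have Ep : p1 = p1' by rewrite P1 P1'.
have Cdq : AC *m (q1 - q1') = 0.
  rewrite mulmxBr; apply/eqP; rewrite subr_eq0; apply/eqP.
  by move: F1'; rewrite -F1; do 4 move/addIr.
(* The difference lies in the kernel of [AC], while [DC q0] sends it into the range of [AC^T]; hence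
   the form of [DC q0] vanishes at it. *)
have Eq : q1 = q1'.
  apply/eqP; rewrite -subr_eq0; apply/eqP; apply: (@defC q0).
  rewrite -mulmxA mulmxBr -C1 -C1' -mulmxBr mulmxA mulmx_tr_eq0 //.
  by rewrite mul0mx.
clear P1 P1'; subst p1' q1'.
have Cde : AC^T *m (e1 - e1') = 0 by rewrite mulmxBr C1 C1' subrr.
have Vde : AV^T *m (e1 - e1') = 0 by rewrite mulmxBr V1 V1' subrr.
have row1 : AC *m (q2 - q2') + AV *m (j1 - j1')
    + AR *m Dg (AR^T *m e0) *m AR^T *m (e1 - e1') = 0.
  have := congr2 (fun a b => a - b) G1 G1'; rewrite subrr => <-.
  rewrite !mulmxBr !mulmxA; apply/matrixP => a b.
  rewrite !(addmxE, oppmxE, zeromxE); ring.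
(* Tested against [e1 - e1'], the capacitive and source terms of [row1] drop out and only the
   resistive form remains. *)
have Rde : AR^T *m (e1 - e1') = 0.
  apply: (definite_congr_eq0 (@defg (AR^T *m e0))).
  have := congr1 (mulmx (e1 - e1')^T) row1.
  by rewrite mulmx0 !mulmxDr !mulmxA (tr_mul_eq0 Cde) (tr_mul_eq0 Vde)
    ?(tr_mul_eq0 Rde) !mul0mx !add0r.
split=> //; move: row1.
by rewrite -[X in _ + X]mulmxA Rde mulmx0 addr0.
Qed.

Lemma level2_diff q0 q1 q1' q2 q2' q3 q3' p0 p1 p1' p2 p2' p3 p3'
    e0 e1 e1' e2 e2' j0 j1 j1' j2 j2' :
  level0 q0 q1 p0 p1 e0 j0 -> level0 q0 q1' p0 p1' e0 j0 ->
  level1 q0 q1 q2 p0 p1 p2 e0 e1 j1 -> level1 q0 q1' q2' p0 p1' p2' e0 e1' j1' ->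
  level2 q0 q1 q2 q3 p0 p1 p2 p3 e0 e1 e2 j2 ->
  level2 q0 q1' q2' q3' p0 p1' p2' p3' e0 e1' e2' j2' ->
  [/\ q1 = q1', p1 = p1', e1 = e1', j1 = j1' & q2 = q2'].
Proof.
move=> L0 L0' L1 L1'.
have [Eq Ep CVd [Cde Rde Vde]] := level1_diff L0 L0' L1 L1'; subst q1' p1'.
case: L1 L1' => _ P2 _ _ [_ P2' _ _].
have ER : AR^T *m e1 = AR^T *m e1' by apply/eqP; rewrite -subr_eq0 -mulmxBr Rde.
case=> G2 _ C2 V2 [G2' _ C2' V2'].
have row2 : AC *m (q3 - q3') + AV *m (j2 - j2')
    + AR *m Dg (AR^T *m e0) *m AR^T *m (e2 - e2')
    + AL *m DL p0 *m AL^T *m (e1 - e1') = 0.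
  have := congr2 (fun a b => a - b) G2 G2'; rewrite subrr => <-.
  rewrite P2 P2' ER !(mulmxBr, mulmxDr) !mulmxA; apply/matrixP => a b.
  rewrite !(addmxE, oppmxE, zeromxE); ring.
(* In [row2] the inductor term carries [p2 - p2'], which is [AL^T] of [e1 - e1']. Testing against
   that same vector isolates the form of [DL p0]. *)
have Ee : e1 = e1'.
  apply/eqP; rewrite -subr_eq0; apply/eqP; apply: CRLV_inj => //.
  apply: (definite_congr_eq0 (@defL p0)).
  have := congr1 (mulmx (e1 - e1')^T) row2.
  by rewrite mulmx0 !mulmxDr !mulmxA (tr_mul_eq0 Cde) (tr_mul_eq0 Vde)
    ?(tr_mul_eq0 Rde) !mul0mx !add0r.
have Eq2 : q2 = q2'.
  apply/eqP; rewrite -subr_eq0; apply/eqP; apply: (@defC q0).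
  (* By the second derivative of the capacitor equation, [DC q0 *m (q2 - q2')] is
     [AC^T *m (e2 - e2')]. Since [AV^T *m (e2 - e2') = 0], the source currents may be added, and the
     current law [CVd] makes the sum vanish. *)
  have -> : (q2 - q2')^T *m DC q0 *m (q2 - q2') =
      (AC *m (q2 - q2') + AV *m (j1 - j1'))^T *m (e2 - e2').
    rewrite [(AC *m _ + _)^T]linearD /= !trmx_mul mulmxDl.
    rewrite -[(q2 - q2')^T *m DC q0 *m _]mulmxA.
    rewrite -!mulmxA [AV^T *m _]mulmxBr V2 V2' subrr mulmx0 addr0.
    by rewrite [AC^T *m _]mulmxBr C2 C2' [in RHS]opprD addrACA subrr addr0 -mulmxBr.
  by rewrite CVd trmx0 mul0mx.
split=> //; apply/eqP; rewrite -subr_eq0; apply/eqP; apply: AV_inj.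
by move: CVd; rewrite Eq2 subrr mulmx0 add0r.
Qed.

(** Source of non-uniqueness at order 1: the flux equation only transfers [de] to [p2], which is a
    free unknown at this level. *)
Lemma level1_shift q0 q1 q2 p0 p1 p2 e0 e1 j1 dq de dj :
  AC *m dq + AV *m dj = 0 ->
  AC^T *m de = 0 -> AR^T *m de = 0 -> AV^T *m de = 0 ->
  level1 q0 q1 q2 p0 p1 p2 e0 e1 j1 ->
  level1 q0 q1 (q2 + dq) p0 p1 (p2 + AL^T *m de) e0 (e1 + de) (j1 + dj).
Proof.
move=> CVd Cd Rd Vd [F1 P1 C1 V1]; split; last 3 first.
- by rewrite P1 mulmxDr.
- by rewrite mulmxDr Cd addr0.
- by rewrite mulmxDr Vd addr0.
rewrite [AR^T *m (e1 + de)]mulmxDr Rd addr0 -[RHS]addr0 -{1}F1 -CVd !mulmxDr.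
apply/matrixP => a b; rewrite !(addmxE, oppmxE); ring.
Qed.

(** The values [q0], [p0], [e0], [j0] stay fixed. Only [q1] may have to move, within a fibre of
    [AC], to meet the differentiated capacitor equation; the kernel condition on [AC] and [AV] keeps
    [j0] in place. *)
Lemma level1_exists q0 q1 p0 p1 e0 j0 :
  (forall u, AC^T *m u = 0 -> AR^T *m u = 0 -> AV^T *m u = 0 -> u = 0) ->
  (forall (wc : 'cV_nc) (wv : 'cV_nv), AC *m wc + AV *m wv = 0 -> wv = 0) ->
  level0 q0 q1 p0 p1 e0 j0 ->
  exists q1' q2 p2 e1 j1, [/\ AC *m q1' = AC *m q1,
    level0 q0 q1' p0 p1 e0 j0 & level1 q0 q1' q2 p0 p1 p2 e0 e1 j1].
Proof.
move=> CRV_inj CV_inj [F0 P0 C0 V0].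
have [q1' [j0' [e1 [E C1 V1]]]] := capacitive_step q1 j0 0 v1 (@defC q0).
have Ej : j0' = j0.
  apply/eqP; rewrite -subr_eq0; apply/eqP; apply: (CV_inj (q1' - q1)).
  by rewrite !mulmxBr addrACA -opprD E subrr.
have Eq : AC *m q1' = AC *m q1 by move: E; rewrite Ej => /addIr.
have [u Cu Ru Vu|e1' [q2 [j1 [C1' V1' G1]]]] :=
  resistive_step e1 (c := AL *m (DL p0 *m p1) + s1) (@defg (AR^T *m e0)).
  by rewrite (CRV_inj u) // trmx0 mul0mx.
exists q1', q2, (AL^T *m e1'), e1', j1; split=> //; split=> //.
- by rewrite Eq.
- by rewrite -[RHS]G1; apply/matrixP => a b; rewrite !(addmxE, zeromxE); ring.
- by rewrite C1' C1 addr0.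
- by rewrite V1'.
Qed.

(** The three correction steps are interleaved: the current law of one level is solvable only after
    [inductive_step] has adjusted the potential one level below. Charges [q0] and fluxes [p0] never
    move. *)
Lemma level2_exists q0 q1 p0 p1 e0 j0 :
  level0 q0 q1 p0 p1 e0 j0 ->
  exists q1' q2 q3 p1' p2 p3 e0' e1 e2, exists j0' j1 j2,
  [/\ level0 q0 q1' p0 p1' e0' j0', level1 q0 q1' q2 p0 p1' p2 e0' e1 j1
    & level2 q0 q1' q2 q3 p0 p1' p2 p3 e0' e1 e2 j2].
Proof.
case=> F0 P0 C0 V0.
(* [Le0] is the solvability condition of the level 1 current law; it forces the choice of [e0']
   before anything else. *)
have [e0' [C0' R0' V0' Le0]] := inductive_step e0 s1 (@defL p0).
have [q1' [j0' [e1 [E1 C1 V1]]]] := capacitive_step q1 j0 0 v1 (@defC q0).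
pose p1' := AL^T *m e0'.
have [u|e1' [q2 [j1 [C1' V1' G1]]]] := resistive_step e1
  (c := AL *m (DL p0 *m p1') + s1) (@defg (AR^T *m e0')); first exact: Le0.
(* The same repair one level up. It leaves [AR^T *m e1'] unchanged, so the level 1 current law just
   solved is not disturbed. *)
have [e1'' [C1'' R1'' V1'' Le1]] :=
  inductive_step e1' (AL *m D2L p0 p1' + s2) (@defL p0).
pose p2 := AL^T *m e1''.
have [q2' [j1' [e2 [E2 C2 V2]]]] :=
  capacitive_step q2 j1 (D2C q0 q1') v2 (@defC q0).
have [u Cu Ru Vu|e2' [q3 [j2 [C2' V2' G2]]]] := resistive_step e2
  (c := AL *m (DL p0 *m p2 + D2L p0 p1')
        + AR *m D2g (AR^T *m e0') (AR^T *m e1'') + s2) (@defg (AR^T *m e0')).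
  (* The second-order resistive term lies in the range of [AR], hence is orthogonal to [u] and need
     not appear in [Le1]. *)
  have := Le1 u Cu Ru Vu; rewrite !mulmxDr !mulmxA (tr_mul_eq0 Ru).
  by rewrite !mul0mx addr0 addrA.
exists q1', q2', q3, p1', p2, (AL^T *m e2'), e0', e1'', e2', j0', j1', j2.
split; split=> //.
- by rewrite R0' -[RHS]F0 -(addrAC (AC *m q1')) E1; congr (_ + _ + _); rewrite addrAC.
- by rewrite C0'.
- by rewrite V0'.
- by rewrite R1'' -(addrAC (AC *m q2')) E2 -[RHS]G1; apply/matrixP => a b;
    rewrite !(addmxE, zeromxE); ring.
- by rewrite C1'' C1' C1 addr0.
- by rewrite V1'' V1'.
- by rewrite -[RHS]G2 [AR *m (_ + _)]mulmxDr; apply/matrixP => a b;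
    rewrite !(addmxE, zeromxE); ring.
- by rewrite C2'.
- by rewrite V2'.
Qed.

End CircuitEquations.

(** * Paths, cycles and cuts *)

Section GraphConnectivity.
Variable G : circuit.
Implicit Types (S : {set edge G}) (v w : vertex G) (a : edge G) (d : oedge G).

Definition adjacent S : rel (vertex G) := fun v w =>
  [exists d : oedge G, [&& d.1 \in S, oinit d == v & oter d == w]].

Lemma adjacent_edge S a : a \in S -> adjacent S (init a) (ter a).
Proof. by move=> aS; apply/existsP; exists (a, false); rewrite aS !eqxx. Qed.

Lemma adjacent_sym S : symmetric (adjacent S).
Proof.
suff imp v w : adjacent S v w -> adjacent S w v by move=> v w; apply/idP/idP; apply: imp.
case/existsP=> -[a b] /and3P[/= aS /eqP <- /eqP <-].
by apply/existsP; exists (a, ~~ b); rewrite aS /oinit /oter; case: b; rewrite !eqxx.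
Qed.

Lemma connect_adjacent_sym S : connect_sym (adjacent S).
Proof. exact/sym_connect_sym/adjacent_sym. Qed.

(** Lifts a vertex walk to oriented edges. The two equations on initial and terminal vertices carry
    the walk from here on: distinctness is read off the vertices, chaining comes from
    [walk_chain]. *)
Lemma adjacent_walk S v p : path (adjacent S) v p ->
  exists P : seq (oedge G), [/\ all (fun d => d.1 \in S) P,
    map (@oinit G) P = belast v p & map (@oter G) P = p].
Proof.
elim: p v => [|x p IH] v /=; first by exists [::].
case/andP=> /existsP[d /and3P[dS /eqP <- /eqP <-]] /IH[P [PS Pi Pt]].
by exists (d :: P); rewrite /= dS PS Pi Pt.
Qed.

Lemma walk_chain d P v p :
  map (@oinit G) (d :: P) = belast v p -> map (@oter G) (d :: P) = p ->
  [/\ path (fun c c' : oedge G => oter c == oinit c') d P, oinit d = v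
    & oter (last d P) = last v p].
Proof.
elim: P d v p => [|d' P IH] d v [|x p] //=; case: p => [|y p] //=.
  by case=> <- [<-].
case=> <- d'x Pi [dx dt Pt]; have [] := IH d' x (y :: p).
- by rewrite /= d'x Pi.
- by rewrite /= dt Pt.
by move=> -> _ ->; rewrite dx d'x eqxx.
Qed.

(** If the first edge came back in either orientation, its start [v] would be an end of a later edge
    and so occur in [p]. *)
Lemma walk_uniq_edges P v p : uniq (v :: p) ->
  map (@oinit G) P = belast v p -> map (@oter G) P = p -> uniq (map fst P).
Proof.
elim: P v p => [|d P IH] v [|x p] //= /andP[vxp up] [dv Pi] [dx Pt].
rewrite (IH x p) // andbT; apply: contra vxp => /mapP[d' d'P dd'].
have : oinit d' \in x :: p.
  by apply: mem_belast; rewrite -Pi map_f.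
have : oter d' \in x :: p by rewrite inE -Pt map_f ?orbT.
move: dv dd'; rewrite /oinit /oter; case: d {dx} => a b /= <- ->.
by case: b; case: d'.2.
Qed.

(** [shortenP] makes the vertices distinct, as [is_path] demands; the empty walk accounts for the
    disjunct [v = w]. *)
Lemma vconnectedE S v w : vconnected S v w = connect (adjacent S) v w.
Proof.
apply/asboolP/idP => [[->|[[|d p] // /and5P[pS _ ch /eqP <- /eqP <-]]]|].
- exact: connect0.
- elim: p d pS ch => [|d' p IH] d /=; case/andP=> dS pS.
    by move=> _; apply: connect1; apply/existsP; exists d; rewrite dS !eqxx.
  case/andP=> /eqP dd' ch; apply: connect_trans (IH d' pS ch).
  by apply: connect1; apply/existsP; exists d; rewrite dS dd' !eqxx.
case/connectP=> p0 /shortenP[[|x p] + + _ ->]; first by left.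
move=> /adjacent_walk[[|d P] [// PS Pi Pt]] uxp; right; exists (d :: P).
have [ch dv last_p] := walk_chain Pi Pt.
apply/and5P; split=> //.
- by rewrite Pi; apply: (subseq_uniq _ uxp); rewrite [v :: _]lastI; exact: subseq_rcons.
- by rewrite dv.
- by rewrite last_p.
Qed.

Lemma connect_const (T : eqType) (f : vertex G -> T) S :
  (forall a, a \in S -> f (init a) = f (ter a)) ->
  forall v w, connect (adjacent S) v w -> f v = f w.
Proof.
move=> fS v w /connectP[p + ->]; elim: p v => //= x p IH v /andP[+ /IH <-].
case/existsP=> -[a b] /and3P[/= /fS aS /eqP <- /eqP <-].
by rewrite /oinit /oter /=; case: b.
Qed.

Lemma connected_graphP : connected_graph G ->
  forall v w, connect (adjacent [set: edge G]%SET) v w.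
Proof.
move=> /eqP/cards1P[A EA] v w.
have cl x : [set y in [set: vertex G] | vconnected [set: edge G] x y]%SET = A.
  by apply/set1P; rewrite -EA; apply: imset_f; rewrite inE.
by have /setP/(_ w) := etrans (cl v) (esym (cl w)); rewrite !inE /= !vconnectedE connect0.
Qed.

(* A minimal disconnecting subset of the edges of the given kinds is a cut. *)
Lemma cut_of_disconnected (K : seq component) v0 w0 : connected_graph G ->
  ~~ connect (adjacent [set a | kind a \notin K]%SET) v0 w0 -> has_cut_in G K.
Proof.
move=> /connected_graphP Gc nvw.
pose P (S : {set edge G}) := (S \subset [set a | kind a \in K]%SET) &&
  [exists v, exists w, ~~ connect (adjacent (~: S)%SET) v w].
have P0 : P [set a | kind a \in K]%SET.
  rewrite /P subxx; apply/existsP; exists v0; apply/existsP; exists w0.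
  by congr (~~ connect (adjacent _) _ _): nvw; apply/setP => a; rewrite !inE.
have [S /minsetP[/andP[SK /existsP[v /existsP[w nvwS]]] minS] _] :=
  minset_exists P0.
have [a aS] : exists a, a \in S.
  apply/set0Pn; apply: contraNneq nvwS => ->; rewrite finset.setC0; exact: Gc.
(* By minimality of [S], giving back the single edge [a] reconnects the graph. *)
have conn x y : connect (adjacent (~: (S :\ a))%SET) x y.
  apply: contraT => nxy; have /minS : P (S :\ a)%SET.
    rewrite /P (fintype.subset_trans (finset.subsetDl _ _) SK); apply/existsP; exists x.
    by apply/existsP; exists y.
  by move=> /(_ (finset.subsetDl _ _)) /setP/(_ a); rewrite !inE eqxx aS.
pose c := connect (adjacent (~: S)%SET).
have csym : symmetric c by exact: connect_adjacent_sym.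
(* The property [f] of being joined to an end of [a] is preserved along the edges outside [S] and
   along [a] itself, hence holds everywhere. *)
have two x : c (init a) x || c (ter a) x.
  pose f x := c (init a) x || c (ter a) x.
  suff fE y z : connect (adjacent (~: (S :\ a))%SET) y z -> f y = f z.
    by rewrite -/(f x) -(fE _ _ (conn (init a) x)) /f /c connect0.
  apply: connect_const y z => b; rewrite !inE negb_and negbK.
  case/orP=> [/eqP ->|bS]; first by rewrite /f /c !connect0 orbT.
  have /connect1 cb : adjacent (~: S)%SET (init b) (ter b).
    by apply: adjacent_edge; rewrite inE.
  by rewrite /f /c !(same_connect_r (connect_adjacent_sym _) cb).
(* If the two ends of [a] were joined outside [S], then so would be [v] and [w]. *)
have ndist : ~~ c (init a) (ter a).
  apply: contra nvwS => ia; apply: (@connect_trans _ _ (init a)).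
    rewrite connect_adjacent_sym; have /orP[//|] := two v.
    exact: connect_trans.
  by have /orP[//|] := two w; exact: connect_trans.
exists S; last by move=> b /(fintype.subsetP SK); rewrite inE.
pose cl x := [set y in [set: vertex G] | vconnected (~: S) x y]%SET.
have clE x y : c x y -> cl x = cl y.
  move=> cxy; apply/setP => z; rewrite !inE /= !vconnectedE.
  exact: (same_connect (connect_adjacent_sym _) cxy z).
rewrite /is_cut; suff -> : @components G (~: S)%SET = [set cl (init a); cl (ter a)]%SET.
  rewrite cards2; suff -> : cl (init a) != cl (ter a) by [].
  apply: contra ndist => /eqP/setP/(_ (ter a)).
  by rewrite !inE /= !vconnectedE connect0.
apply/setP => A; rewrite !inE; apply/imsetP/orP => [[x _ ->]|].
  by have /orP[] := two x => /clE E; [left|right]; apply/eqP/esym; exact: E.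
by case=> /eqP ->; eexists; rewrite ?inE.
Qed.

(** The complement of the cut contains every edge of a kind outside [K]. If those edges connected
    all vertices, the complement would have one component instead of two. *)
Lemma disconnected_of_cut (K : seq component) : has_cut_in G K ->
  exists v w, ~~ connect (adjacent [set a | kind a \notin K]%SET) v w.
Proof.
case=> S Scut SK; apply: contrapT => nex; have := Scut.
have conn x y : connect (adjacent (~: S)%SET) x y.
  apply: contraT => nxy; exfalso; apply: nex; exists x, y; apply: contra nxy.
  apply: connect_sub => z t /existsP[d /and3P[dK di dt]]; apply: connect1.
  apply/existsP; exists d; rewrite di dt !andbT finset.inE.
  by move: dK; rewrite inE; apply: contra; exact: SK.
rewrite /is_cut; suff -> : @components G (~: S)%SET = [set [set: vertex G]]%SET.
  by rewrite cards1.
rewrite -[[set [set: vertex G]]%SET](_ : [set [set: vertex G] | x in [set: vertex G]]%SET = _).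
  apply: eq_imset => x; apply/setP => y; rewrite !inE /= vconnectedE; exact: conn.
apply/setP => A; rewrite !inE; apply/imsetP/eqP => [[x _ ->] //|->].
(* The ground vertex shows that the vertex set is not empty. *)
by exists (ground G); rewrite ?inE.
Qed.

(** A simple path from the end of [a] back to its start is closed up by [a]; as the path avoids [a],
    no edge is traversed twice. *)
Lemma cycle_of_connect S a : a \in S ->
  connect (adjacent (S :\ a)%SET) (ter a) (init a) ->
  exists p, [/\ is_cycle p, all (fun d => d.1 \in S) p & a \in map fst p].
Proof.
move=> aS /connectP[p0 /shortenP[p + uxp _] Elast].
move=> /adjacent_walk[P [PS Pi Pt]].
have aP : a \notin map fst P.
  by apply/mapP => -[d /(allP PS) + ad]; rewrite -ad !inE eqxx.
have PS' : all (fun d => d.1 \in S) P.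
  by apply/allP => d /(allP PS); rewrite inE => /andP[].
exists ((a, false) :: P); split; last 2 first.
- by rewrite /= aS.
- by rewrite inE eqxx.
split; first by rewrite /= aP (walk_uniq_edges uxp).
have [ch _ last_p] := @walk_chain (a, false) P (init a) (ter a :: p)
  (congr1 (cons (init a)) Pi) (congr1 (cons (ter a)) Pt).
exists (init a); apply/and5P; split=> //.
- by apply/allP => d; rewrite inE.
- rewrite map_cons Pi; move: uxp; rewrite lastI rcons_uniq -Elast.
  by rewrite /= /oinit.
- by rewrite last_p /= -Elast.
Qed.

End GraphConnectivity.

(** * Kernels of incidence matrices *)

Section IncidenceKernels.
Variables (R : realType) (G : circuit).
Implicit Types (w : edge G -> R) (a : edge G) (v : vertex G).
Local Notation A c := (incidence G R c).

Definition branch_vec c w : 'cV[R]_(n_branch G c) := \col_j w (enum_val j).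

(** Extension by zero to all edges, so that currents in branches of different kinds can be added as
    functions on one edge set. *)
Definition branch_ext c (x : 'cV[R]_(n_branch G c)) a : R :=
  \sum_j (enum_val j == a)%:R * x j 0.

(* The grounded vertex has potential 0. *)
Definition node_ext (u : 'cV[R]_(n_node G)) v : R :=
  \sum_i (enum_val i == v)%:R * u i 0.

Lemma branch_ext_val c (x : 'cV_(n_branch G c)) j :
  branch_ext x (enum_val j) = x j 0.
Proof.
rewrite /branch_ext (bigD1 j) //= eqxx mul1r big1 ?addr0 // => i ij.
by rewrite (inj_eq enum_val_inj) (negbTE ij) mul0r.
Qed.

Lemma branch_ext_eq0 c (x : 'cV_(n_branch G c)) a : kind a != c -> branch_ext x a = 0.
Proof.
move=> ac; apply: big1 => i _; case: eqP => [ia|_]; last by rewrite mul0r.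
by case/negP: ac; rewrite -ia; have := enum_valP i; rewrite inE.
Qed.

Lemma branch_ext_vec c w a :
  branch_ext (branch_vec c w) a = if kind a == c then w a else 0.
Proof.
case: ifPn => [ac|/branch_ext_eq0 -> //].
have aS : a \in branch_set G c by rewrite inE.
by rewrite -[a in LHS](enum_rankK_in aS aS) branch_ext_val mxE enum_rankK_in.
Qed.

Lemma node_ext_val u i : node_ext u (enum_val i) = u i 0.
Proof.
rewrite /node_ext (bigD1 i) //= eqxx mul1r big1 ?addr0 // => k ki.
by rewrite (inj_eq enum_val_inj) (negbTE ki) mul0r.
Qed.

Lemma node_ext_ground u : node_ext u (ground G) = 0.
Proof.
apply: big1 => i _; case: eqP => [ig|_]; last by rewrite mul0r.
by have := enum_valP i; rewrite ig !inE eqxx.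
Qed.

(** The nested tests become a difference of indicators because no edge is a loop. *)
Lemma incidence_entryE v a :
  incidence_entry R v a = (init a == v)%:R - (ter a == v)%:R.
Proof.
rewrite /incidence_entry; have := loop_free a.
case: (init a =P v) => [<- /negbTE|_ _]; last first.
  by case: (ter a =P v) => _ /=; rewrite ?mulr0n ?mulr1n ?sub0r ?oppr0.
by rewrite eq_sym => ->; rewrite subr0.
Qed.

Lemma mul_incidence c (x : 'cV_(n_branch G c)) i :
  (A c *m x) i 0 = \sum_a incidence_entry R (enum_val i) a * branch_ext x a.
Proof.
rewrite mxE; under [RHS]eq_bigr do rewrite /branch_ext big_distrr /=.
rewrite exchange_big /=; apply: eq_bigr => j _; rewrite mxE.
rewrite (bigD1 (enum_val j)) //= eqxx mul1r big1 ?addr0 // => a.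
by rewrite eq_sym => /negbTE ->; rewrite mul0r mulr0.
Qed.

Lemma mul_incidence_tr c (u : 'cV_(n_node G)) j :
  ((A c)^T *m u) j 0 = node_ext u (init (enum_val j)) - node_ext u (ter (enum_val j)).
Proof.
rewrite mxE /node_ext -sumrB; apply: eq_bigr => i _.
by rewrite !mxE incidence_entryE mulrBl ![enum_val i == _]eq_sym.
Qed.

Lemma incidence_tr_eq0 c (u : 'cV_(n_node G)) : (A c)^T *m u = 0 <->
  forall a, kind a = c -> node_ext u (init a) = node_ext u (ter a).
Proof.
split=> [Au a ac|uc].
  have aS : a \in branch_set G c by rewrite inE ac.
  apply/eqP; rewrite -subr_eq0 -(enum_rankK_in aS aS) -mul_incidence_tr.
  by rewrite Au mxE.
apply/colP => j; rewrite mul_incidence_tr mxE uc ?subrr //.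
by have := enum_valP j; rewrite inE => /eqP.
Qed.

(** The circulations, that is, the kernel of the all-vertex incidence matrix. *)
Definition balanced w : Prop :=
  forall v, \sum_a incidence_entry R v a * w a = 0.

(* Kirchhoff's law at the ground follows, as the law at all vertices adds up to 0. *)
Lemma balanced_nodes w :
  (forall i : 'I_(n_node G), \sum_a incidence_entry R (enum_val i) a * w a = 0) ->
  balanced w.
Proof.
move=> wi v.
have wn x : x != ground G -> \sum_a incidence_entry R x a * w a = 0.
  move=> xg; have xS : x \in node_set G by rewrite !inE.
  by have := wi (enum_rank_in xS x); rewrite enum_rankK_in.
have [->|/wn //] := eqVneq v (ground G).
have : \sum_x \sum_a incidence_entry R x a * w a = 0.
  rewrite exchange_big big1 //= => a _; rewrite -mulr_suml.
  under eq_bigr do rewrite incidence_entryE.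
  rewrite sumrB (bigD1 (init a)) //= eqxx big1 => [|x]; last first.
    by rewrite eq_sym => /negbTE ->.
  rewrite [X in _ - X](bigD1 (ter a)) //= eqxx big1 => [|x]; last first.
    by rewrite eq_sym => /negbTE ->.
  by rewrite subrr mul0r.
by rewrite (bigD1 (ground G)) //= [X in _ + X]big1 ?addr0.
Qed.

(** Otherwise take the component of [ter a0] in [S] without [a0], with indicator [f]. The net flow
    of a circulation across it is zero, yet any other edge carrying current has both ends on the
    same side, so the flow is that of [a0] alone. *)
Lemma connect_of_balanced w (S : {set edge G}) a0 : balanced w ->
  (forall a, w a != 0 -> a \in S) -> w a0 != 0 ->
  connect (adjacent (S :\ a0)%SET) (ter a0) (init a0).
Proof.
move=> wb wS; apply: contraNT => nc.
pose f v : R := (connect (adjacent (S :\ a0)%SET) (ter a0) v)%:R.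
have: \sum_v f v * \sum_a incidence_entry R v a * w a = 0.
  by apply: big1 => v _; rewrite wb mulr0.
under eq_bigr do rewrite big_distrr /=.
rewrite exchange_big /= (bigD1 a0) //=.
have pick1 x : \sum_v f v * (x == v)%:R = f x.
  rewrite (bigD1 x) //= eqxx mulr1 big1 ?addr0 // => y.
  by rewrite eq_sym => /negbTE ->; rewrite mulr0.
have sumE a : \sum_v f v * (incidence_entry R v a * w a) =
    (f (init a) - f (ter a)) * w a.
  under eq_bigr do rewrite incidence_entryE mulrA mulrBr.
  by rewrite -mulr_suml sumrB !pick1.
rewrite sumE big1 ?addr0 => [|a aa0].
  by rewrite /f (negbTE nc) connect0 sub0r mulN1r => /eqP; rewrite oppr_eq0.
rewrite sumE; have [->|/wS aS] := eqVneq (w a) 0; first by rewrite mulr0.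
have /connect1 ca : adjacent (S :\ a0)%SET (init a) (ter a).
  by apply: adjacent_edge; rewrite !inE aa0.
by rewrite /f (same_connect_r (connect_adjacent_sym _) ca) subrr mul0r.
Qed.

(** Unit current around the cycle, with a sign for each reversed edge. Its divergence at a vertex
    telescopes along the path to a difference of two equal indicators. *)
Lemma balanced_of_cycle p : is_cycle p ->
  exists2 w, balanced w & forall a, (w a != 0) = (a \in map fst p).
Proof.
case=> up [v0 pv]; pose sg (d : oedge G) : R := (-1) ^+ d.2.
exists (fun a => \sum_(d <- p | d.1 == a) sg d) => [v|a].
  under eq_bigr do rewrite big_distrr /= big_mkcond /=.
  rewrite exchange_big /=.
  have sumE d : \sum_a (if d.1 == a then incidence_entry R v a * sg d else 0) =
      (oinit d == v)%:R - (oter d == v)%:R.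
    rewrite -big_mkcond (big_pred1 d.1) => [|a]; last by rewrite /= eq_sym.
    rewrite incidence_entryE /sg /oinit /oter; case: d => a [] /=.
      by rewrite expr1 mulrN1 opprB.
    by rewrite expr0 mulr1.
  under eq_bigr do rewrite sumE.
  case: p pv {up} => // d p /and5P[_ _ ch /eqP di /eqP dt].
  have -> : \sum_(c <- d :: p) ((oinit c == v)%:R - (oter c == v)%:R) =
      (oinit d == v)%:R - (oter (last d p) == v)%:R :> R.
    elim: p d ch {di dt} => [|c p IH] d /=; first by rewrite big_seq1.
    by case/andP=> /eqP dc /IH E; rewrite big_cons E dc addrA subrK.
  by rewrite di dt subrr.
have out p' : a \notin map fst p' -> \sum_(d <- p' | d.1 == a) sg d = 0.
  move=> ap; rewrite big1_seq // => d /andP[/eqP da dp].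
  by case/negP: ap; rewrite -da map_f.
have [/mapP[d dp Ea]|/out ->] := boolP (a \in map fst p); last by rewrite eqxx.
(* Since no edge is repeated, the sum at [a] has a single term, a sign, and nothing can cancel. *)
case/splitPr: dp up {pv} => p1 p2; rewrite map_cat cat_uniq /= negb_or -Ea.
case/and3P=> _ /andP[ap1 _] /andP[ap2 _].
rewrite big_cat big_cons /= -Ea eqxx (out _ ap1) (out _ ap2) add0r addr0.
by rewrite signr_eq0.
Qed.


Local Notation A_C := (incidence G R Capacitance).
Local Notation A_R := (incidence G R Resistance).
Local Notation A_L := (incidence G R Inductance).
Local Notation A_V := (incidence G R VoltageSource).

Lemma branch_ext0 c a : branch_ext (0 : 'cV_(n_branch G c)) a = 0.
Proof. by apply: big1 => i _; rewrite mxE mulr0. Qed.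

Lemma branch_ext_neq0 c (x : 'cV_(n_branch G c)) : x != 0 ->
  exists2 a, kind a = c & branch_ext x a != 0.
Proof.
move=> x0; have [j xj] : exists j, x j 0 != 0.
  apply: contra_notP (negP x0) => nx; apply/eqP/colP => j; rewrite mxE.
  by apply: contra_notP nx => /eqP xj; exists j.
exists (enum_val j); last by rewrite branch_ext_val.
by have := enum_valP j; rewrite inE => /eqP.
Qed.

(** The kernel vector is a circulation, and a cycle through [a0] is found inside its support.
    Working in the support gives the kinds of the edges, including the sharper conclusion when
    [wc = 0]. *)
Lemma cycle_of_kernel (wc : 'cV_(nC G)) (wv : 'cV_(nV G)) a0 :
  A_C *m wc + A_V *m wv = 0 -> branch_ext wc a0 + branch_ext wv a0 != 0 ->
  exists p, [/\ cycle_in [:: Capacitance; VoltageSource] p, a0 \in map fst p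
    & wc = 0 -> cycle_in [:: VoltageSource] p].
Proof.
move=> Aw a0w; pose w a := branch_ext wc a + branch_ext wv a.
have wb : balanced w.
  apply: balanced_nodes => i; rewrite /w; under eq_bigr do rewrite mulrDr.
  by rewrite big_split /= -!mul_incidence -addmxE Aw mxE.
have wS a : w a != 0 -> a \in [set b | w b != 0]%SET by rewrite inE.
have [p [cp pS ap]] := cycle_of_connect (wS _ a0w) (connect_of_balanced wb wS a0w).
exists p; split=> //.
  split=> //; apply/allP => d /(allP pS); rewrite !inE /w; apply: contraNT.
  rewrite negb_or => /andP[dC dV].
  by rewrite !branch_ext_eq0 ?addr0.
move=> wc0; split=> //; apply/allP => d /(allP pS); rewrite !inE /w.
by rewrite wc0 branch_ext0 add0r; apply: contraNT => /branch_ext_eq0 ->.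
Qed.

Lemma kernel_of_cycle p : cycle_in [:: Capacitance; VoltageSource] p ->
  exists (wc : 'cV_(nC G)) (wv : 'cV_(nV G)), A_C *m wc + A_V *m wv = 0 /\
    forall a, a \in map fst p -> if kind a == Capacitance
      then branch_ext wc a != 0 else branch_ext wv a != 0.
Proof.
case=> cp /allP pK; have [w wb wp] := balanced_of_cycle cp.
have wK a : w a != 0 -> (kind a == Capacitance) || (kind a == VoltageSource).
  by rewrite wp => /mapP[d /pK + ->]; rewrite !inE.
exists (branch_vec Capacitance w), (branch_vec VoltageSource w); split.
  apply/colP => i; rewrite addmxE !mul_incidence -big_split mxE /=.
  rewrite -[RHS](wb (enum_val i)); apply: eq_bigr => a _.
  rewrite -mulrDr !branch_ext_vec; congr (_ * _).
  have [->|/wK] := eqVneq (w a) 0; first by rewrite !if_same addr0.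
  by case: (kind a); rewrite //= ?addr0 ?add0r.
move=> a; rewrite -wp => wa; rewrite !branch_ext_vec.
by have := wK a wa; case: (kind a == Capacitance) => [_|/= ->].
Qed.

(** A nonzero [wv] puts a voltage source on the cycle; a capacitance must then occur as well, since
    cycles of voltage sources alone are excluded. *)
Lemma CV_mixed_cycleP : ~ has_cycle_in G [:: VoltageSource] ->
  has_CV_cycle_both_types G <->
  exists (wc : 'cV_(nC G)) (wv : 'cV_(nV G)),
    A_C *m wc + A_V *m wv = 0 /\ wv != 0.
Proof.
move=> noV; split=> [[p [/kernel_of_cycle[wc [wv [Aw wp]]] _ /hasP[d dp /eqP dV]]]|].
  exists wc, wv; split=> //; apply: contraTneq isT => wv0.
  by have := wp d.1 (map_f fst dp); rewrite dV /= wv0 branch_ext0 eqxx.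
case=> wc [wv [Aw /branch_ext_neq0[a aV wa]]].
have [|p [cp ap _]] := cycle_of_kernel (a0 := a) Aw.
  by rewrite [branch_ext wc a]branch_ext_eq0 ?aV // add0r.
exists p; split=> //; last first.
  by case/mapP: ap => d dp ad; apply/hasP; exists d; rewrite // -ad aV.
apply: contra_notT noV => noC; exists p; case: (cp) => cyc /allP pK; split=> //.
apply/allP => d dp; have := pK d dp; rewrite !inE => /orP[dC|//].
by case/hasP: noC; exists d.
Qed.

Lemma CV_cycleP : has_cycle_in G [:: Capacitance; VoltageSource] <->
  exists (wc : 'cV_(nC G)) (wv : 'cV_(nV G)),
    A_C *m wc + A_V *m wv = 0 /\ ~ (wc = 0 /\ wv = 0).
Proof.
split=> [[p cp]|[wc [wv [Aw w0]]]].
  have [wc [wv [Aw wp]]] := kernel_of_cycle cp; exists wc, wv; split=> // -[wc0 wv0].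
  (* A cycle is not empty, so its first edge carries a nonzero entry. *)
  case: cp => -[_ [v]]; case: p wp => // d p /(_ d.1 (mem_head _ _)).
  by rewrite wc0 wv0 !branch_ext0 eqxx if_same.
have [wc0|/branch_ext_neq0[a aC wa]] := eqVneq wc 0.
  have /branch_ext_neq0[a aV wa] : wv != 0 by apply/eqP => wv0; apply: w0.
  have [|p [cp _ _]] := cycle_of_kernel (a0 := a) Aw; last by exists p.
  by rewrite [branch_ext wc a]branch_ext_eq0 ?aV // add0r.
have [|p [cp _ _]] := cycle_of_kernel (a0 := a) Aw; last by exists p.
by rewrite [branch_ext wv a]branch_ext_eq0 ?aC // addr0.
Qed.

Lemma voltage_incidence_inj : ~ has_cycle_in G [:: VoltageSource] ->
  forall wv : 'cV_(nV G), A_V *m wv = 0 -> wv = 0.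
Proof.
move=> noV wv Aw; apply/eqP; apply: contra_notT noV => /branch_ext_neq0[a aV wa].
have [||p [_ _ cp]] := @cycle_of_kernel 0 wv a.
- by rewrite mulmx0 add0r.
- by rewrite branch_ext0 add0r.
by exists p; exact: cp.
Qed.

(** From a cut, take the indicator of one component of the graph without the edges of kinds in [K],
    shifted to vanish at the ground. Conversely, a potential constant along those remaining edges
    separates any node of nonzero potential from the ground. *)
Lemma cut_potentialP (K : seq component) : connected_graph G ->
  has_cut_in G K <-> exists2 u : 'cV_(n_node G), u != 0
    & forall c, c \notin K -> (A c)^T *m u = 0.
Proof.
move=> Gc; split=> [/disconnected_of_cut[v [w nvw]]|[u u0 uK]].
  pose f x : R := (connect (adjacent [set a | kind a \notin K]%SET) v x)%:R.
  pose u : 'cV_(n_node G) := \col_i (f (enum_val i) - f (ground G)).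
  have uE x : node_ext u x = f x - f (ground G).
    have [->|xg] := eqVneq x (ground G); first by rewrite node_ext_ground subrr.
    have xS : x \in node_set G by rewrite !inE.
    by rewrite -[x](enum_rankK_in xS xS) node_ext_val mxE.
  exists u => [|c cK].
    apply: contraNneq nvw => u0.
    have fg x : f x = f (ground G).
      apply/eqP; rewrite -subr_eq0 -uE u0 /node_ext big1 // => i _.
      by rewrite mxE mulr0.
    have := etrans (fg v) (esym (fg w)); rewrite /f connect0.
    by case: connect => // /eqP; rewrite oner_eq0.
  apply/incidence_tr_eq0 => a ac; rewrite !uE; congr (_ - _).
  have /connect1 ca : adjacent [set a | kind a \notin K]%SET (init a) (ter a).
    by apply: adjacent_edge; rewrite inE ac.
  by rewrite /f (same_connect_r (connect_adjacent_sym _) ca).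
have [i ui] : exists i, u i 0 != 0.
  apply: contra_notP (negP u0) => nx; apply/eqP/colP => j; rewrite mxE.
  by apply: contra_notP nx => /eqP uj; exists j.
apply: (@cut_of_disconnected G K (enum_val i) (ground G)) => //.
apply: contra ui => cu; rewrite -node_ext_val (connect_const _ cu).
  by rewrite node_ext_ground.
by move=> a; rewrite inE => /uK/incidence_tr_eq0; exact.
Qed.

Lemma LI_cutP : connected_graph G ->
  has_cut_in G [:: Inductance; CurrentSource] <->
  exists2 u : 'cV_(n_node G), u != 0
    & [/\ A_C^T *m u = 0, A_R^T *m u = 0 & A_V^T *m u = 0].
Proof.
move=> /cut_potentialP ->; split=> -[u u0 uK]; exists u => //.
  by split; apply: uK.
by case: uK => uC uR uV [].
Qed.

Lemma no_I_cut_inj : connected_graph G -> ~ has_cut_in G [:: CurrentSource] ->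
  forall u : 'cV_(n_node G), A_C^T *m u = 0 -> A_R^T *m u = 0 ->
    A_L^T *m u = 0 -> A_V^T *m u = 0 -> u = 0.
Proof.
move=> Gc noI u uC uR uL uV; apply/eqP; apply: contra_notT noI => u0.
by apply/cut_potentialP => //; exists u => // -[].
Qed.

End IncidenceKernels.

(** * Positive definite forms *)

Section MatrixNorm.
Variable R : realType.

Lemma mx_coord_le m n (A : 'M[R]_(m, n)) i j : `|A i j| <= `|A|.
Proof.
by rewrite [leRHS]/Num.Def.normr /= mx_normrE; exact: (le_bigmax _ _ (i, j)).
Qed.

Lemma mx_norm_le m n (A : 'M[R]_(m, n)) e : 0 <= e ->
  (forall i j, `|A i j| <= e) -> `|A| <= e.
Proof.
move=> e0 Ae; rewrite [leLHS]/Num.Def.normr /= mx_normrE.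
by apply: bigmax_le => // -[i j] _; exact: Ae.
Qed.

(** The norm is the largest absolute entry, so a sum of [n] products costs the factor [n]. *)
Lemma norm_mulmx_le m n k (A : 'M[R]_(m, n)) (B : 'M[R]_(n, k)) :
  `|A *m B| <= n%:R * `|A| * `|B|.
Proof.
apply: mx_norm_le => [|i j]; first by rewrite !mulr_ge0.
rewrite mxE (le_trans (ler_norm_sum _ _ _)) //.
have -> : n%:R = \sum_(l < n) 1 :> R by rewrite sumr_const card_ord.
rewrite -mulrA mulr_suml.
by apply: ler_sum => l _; rewrite mul1r normrM ler_pM // mx_coord_le.
Qed.

Definition form n (J : 'M[R]_n) (u w : 'cV[R]_n) : R := (u^T *m J *m w) 0 0.

Lemma form_sym n (J : 'M[R]_n) u w : J^T = J -> form J u w = form J w u.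
Proof.
move=> JT; rewrite /form -[in RHS](trmxK (w^T *m J *m u)) [RHS]mxE.
by rewrite !trmx_mul trmxK JT mulmxA.
Qed.

Lemma form_comb n (J : 'M[R]_n) a b (u w : 'cV_n) : J^T = J ->
  form J (a *: u - b *: w) (a *: u - b *: w) =
  a ^+ 2 * form J u u - 2 * a * b * form J u w + b ^+ 2 * form J w w.
Proof.
move=> JT; have := form_sym u w JT; rewrite /form.
rewrite [(a *: u - _)^T]linearB /= ![(_ *: _)^T]linearZ /=.
rewrite !(mulmxBl, mulmxBr) -!(scalemxAl, scalemxAr) !mxE.
move: (\sum_j _) (\sum_j _) (\sum_j _) (\sum_j _) => x y z t ->; ring.
Qed.

(** The form at [form J w w *: u - form J w u *: w] is [form J w w] times the desired difference. *)
Lemma form_Cauchy_Schwarz n (J : 'M[R]_n) (u w : 'cV_n) : J^T = J -> posdef J ->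
  form J w u ^+ 2 <= form J w w * form J u u.
Proof.
move=> JT Jpd; have [->|w0] := eqVneq w 0.
  by rewrite /form trmx0 !mul0mx mxE expr0n mul0r.
have ww : 0 < form J w w by exact: Jpd.
have Jge0 x : 0 <= form J x x.
  have [->|/Jpd/ltW //] := eqVneq x 0.
  by rewrite /form trmx0 !mul0mx mxE.
have := Jge0 (form J w w *: u - form J w u *: w).
rewrite form_comb // (form_sym u w JT) => le0.
rewrite -(ler_pM2l ww) -subr_ge0; apply: le_trans le0 _.
by rewrite le_eqVlt; apply/orP; left; apply/eqP; ring.
Qed.

(* As u_i = form J (J^-1 e_i) u, the entries of u are bounded by Cauchy-Schwarz. *)
Lemma posdef_lower_bound n (J : 'M[R]_n) : J^T = J -> posdef J ->
  exists2 c, 0 < c & forall u, c * `|u| ^+ 2 <= form J u u.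
Proof.
move=> JT Jpd.
have Ju : J \in unitmx.
  apply: definite_unit => u uJ; apply/eqP; apply: contraT => /Jpd.
  by rewrite uJ mxE ltxx.
have Jge0 x : 0 <= form J x x.
  have [->|/Jpd/ltW //] := eqVneq x 0.
  by rewrite /form trmx0 !mul0mx mxE.
pose x (i : 'I_n) : 'cV[R]_n := invmx J *m delta_mx i 0.
have xE i u : form J (x i) u = u i 0.
  rewrite /form /x trmx_mul trmx_inv JT mulmxKV // -[delta_mx _ _]trmxK.
  by rewrite !trmx_delta -rowE mxE.
(* [K] dominates every [form J (x i) (x i)]; the summand 1 keeps it positive when [n = 0]. *)
pose K := 1 + \sum_i form J (x i) (x i).
have K0 : 0 < K by rewrite ltr_pwDl // sumr_ge0.
exists K^-1; rewrite ?invr_gt0 // => u.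
rewrite ler_pdivrMl //.
have uK i : u i 0 ^+ 2 <= K * form J u u.
  rewrite -xE; apply: le_trans (form_Cauchy_Schwarz _ _ JT Jpd) _.
  rewrite ler_wpM2r // /K (bigD1 i) //= addrCA lerDl addr_ge0 //.
  by rewrite sumr_ge0.
rewrite -[leRHS]sqr_sqrtr ?mulr_ge0 // ?(ltW K0) //.
rewrite ler_sqr ?nnegrE ?sqrtr_ge0 //; apply: mx_norm_le; rewrite ?sqrtr_ge0 //.
by move=> i j; rewrite [j]ord1 -sqrtr_sqr ler_sqrt // ?mulr_ge0 // (ltW K0).
Qed.

End MatrixNorm.

(** * Derivatives of matrix-valued maps *)

Section CurveCalculus.
Variables (R : realType) (V : normedModType R).
Implicit Types x v : V.

Lemma is_derive_mx m n (M : V -> 'M[R]_(m, n)) (dM : 'M[R]_(m, n)) x v :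
  (forall i j, is_derive x v (fun s => M s i j) (dM i j)) -> is_derive x v M dM.
Proof.
move=> Mij; have Mx : derivable M x v by apply/derivable_mxP => i j; case: (Mij i j).
split=> //; rewrite derive_mx //; apply/matrixP => i j; rewrite mxE.
by case: (Mij i j).
Qed.

Lemma is_derive_coord m n (M : V -> 'M[R]_(m, n)) (dM : 'M[R]_(m, n)) x v i j :
  is_derive x v M dM -> is_derive x v (fun s => M s i j) (dM i j).
Proof.
case=> Mx <-; split; last by rewrite derive_mx // mxE.
by move/derivable_mxP: Mx; apply.
Qed.

Lemma is_derive_mulmx m n k (A : 'M[R]_(m, n)) (c : V -> 'M[R]_(n, k))
    (dc : 'M[R]_(n, k)) x v :
  is_derive x v c dc -> is_derive x v (fun s => A *m c s) (A *m dc).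
Proof.
move=> cx; apply: is_derive_mx => i j.
have -> : (fun s => (A *m c s) i j) = \sum_(l < n) (A i l \*: (fun s => c s l j)).
  by apply/funext => s; rewrite mxE fct_sumE.
rewrite mxE; apply: is_derive_sum => l; apply: is_deriveZ.
exact: is_derive_coord.
Qed.

Lemma is_derive_col_mx m n (c : V -> 'cV[R]_m) (d : V -> 'cV[R]_n)
    (dc : 'cV[R]_m) (dd : 'cV[R]_n) x v :
  is_derive x v c dc -> is_derive x v d dd ->
  is_derive x v (fun s => col_mx (c s) (d s)) (col_mx dc dd).
Proof.
move=> cx dx; apply: is_derive_mx => i j.
rewrite mxE; under eq_fun do rewrite mxE.
by case: (fintype.split i) => k; exact: is_derive_coord.
Qed.

Lemma derivable_bigsum (I : Type) (r : seq I) (P : pred I) (F : I -> V -> R) x v :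
  (forall i, derivable (F i) x v) ->
  derivable (fun s => \sum_(i <- r | P i) F i s) x v.
Proof.
move=> dF; elim: r => [|i r IH].
  by under eq_fun do rewrite big_nil; exact: derivable_cst.
under eq_fun do rewrite big_cons.
by case: (P i) => //; exact: (derivableD (dF i) IH).
Qed.

Lemma derivable_bigprod (I : Type) (r : seq I) (P : pred I) (F : I -> V -> R) x v :
  (forall i, derivable (F i) x v) ->
  derivable (fun s => \prod_(i <- r | P i) F i s) x v.
Proof.
move=> dF; elim: r => [|i r IH].
  by under eq_fun do rewrite big_nil; exact: derivable_cst.
under eq_fun do rewrite big_cons.
by case: (P i) => //; exact: (derivableM (dF i) IH).
Qed.

Lemma derivable_det n (M : V -> 'M[R]_n) x v :
  (forall i j, derivable (fun s => M s i j) x v) ->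
  derivable (fun s => \det (M s)) x v.
Proof.
move=> dM; apply: derivable_bigsum => s; apply: derivableM.
  exact: derivable_cst.
exact: derivable_bigprod.
Qed.

(** Cramer's rule: each entry is a cofactor divided by the determinant, both polynomial in the
    entries of [M]. *)
Lemma derivable_invmx n (M : V -> 'M[R]_n) x v :
  (forall s, M s \in unitmx) -> derivable M x v ->
  derivable (fun s => invmx (M s)) x v.
Proof.
move=> Mu /derivable_mxP dM; apply/derivable_mxP => i j.
have -> : (fun s => invmx (M s) i j) =
    (fun s => (\det (M s))^-1) * (fun s => cofactor (M s) j i).
  by apply/funext => s; rewrite /invmx Mu !mxE.
apply: derivableM; last first.
  apply: derivableM; first exact: derivable_cst.
  by apply: derivable_det => k l; under eq_fun do rewrite !mxE; exact: dM.
apply: derivableV; last exact: derivable_det.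
by have := Mu x; rewrite unitmxE unitfE.
Qed.

(** Both difference quotients are the same function of [h]; a directional derivative is thus the
    derivative of a curve. *)
Lemma is_derive_line (W : normedModType R) (f : V -> W) df a b (r : R) :
  is_derive (a + r *: b) b f df -> is_derive r 1 (fun s : R => f (a + s *: b)) df.
Proof.
have E : (fun h : R => h^-1 *: (((fun s : R => f (a + s *: b)) \o shift r) (h *: 1)
      - f (a + r *: b))) =
    (fun h => h^-1 *: ((f \o shift (a + r *: b)) (h *: b) - f (a + r *: b))).
  apply/funext => h; congr (_ *: (f _ - _)).
  by rewrite /= [h *: 1]mulr1 scalerDl addrCA.
by case=> fd <-; split; rewrite /derivable /derive E.
Qed.

End CurveCalculus.

(** * Inverses of passive maps *)

Section PassiveInverse.
Variable R : realType.

Lemma is_derive_jac n m (f : 'cV[R]_n -> 'cV[R]_m) a v :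
  differentiable f a -> is_derive a v f (jac f a *m v).
Proof.
move=> df; split; first exact: diff_derivable.
rewrite deriveE // {1}[v](_ : v = \sum_j v j 0 *: delta_mx j 0); last first.
  apply/colP => i; rewrite summxE (bigD1 i) //= !mxE !eqxx mulr1 big1 ?addr0 // => j.
  by rewrite eq_sym !mxE => /negbTE ->; rewrite mulr0.
rewrite linear_sum /=; apply/colP => i; rewrite summxE mxE.
by apply: eq_bigr => j _; rewrite linearZ !mxE mulrC deriveE.
Qed.

Lemma differentiable_jac_expansion n m (f : 'cV[R]_n -> 'cV[R]_m) a e :
  differentiable f a -> 0 < e ->
  exists2 r, 0 < r & forall h, `|h| < r -> `|f (a + h) - f a - jac f a *m h| <= e * `|h|.
Proof.
move=> df e0; have := diff_locallyx df; set o := 'o _ => fE.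
have /nbhs_ballP[r r0 re] := littleoP [littleo of o] e0.
exists r => // h hr; have -> : jac f a *m h = 'd f a h.
  by rewrite -deriveE //; case: (is_derive_jac h df).
rewrite (addrC a h) fE -(addrA (f a)) (addrC (f a)) addrK addrAC subrr add0r.
apply: re.
by rewrite -ball_normE /= sub0r normrN.
Qed.

Variables (n : nat) (f finv : 'cV[R]_n -> 'cV[R]_n).
Hypothesis (Hf : passive_storage f) (Hinv : cancel f finv).

(** Bijectivity of [f] makes the left inverse [finv] two-sided. *)
Let fK : cancel finv f.
Proof.
have [[h hK Kh] _ _] := Hf; move=> y.
by rewrite -{1}(Kh y) Hinv Kh.
Qed.

Let fdiff x : differentiable f x.
Proof. by have [_ [fd _] _] := Hf; exact: fd. Qed.

Let fT x : (jac f x)^T = jac f x. Proof. by have [_ _ /(_ x)[]] := Hf. Qed.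

Let fpd x : posdef (jac f x). Proof. by have [_ _ /(_ x)[]] := Hf. Qed.

Let dot (u w : 'cV[R]_n) : R := form 1%:M u w.

Let dotE u w : dot u w = (u^T *m w) 0 0.
Proof. by rewrite /dot /form mulmx1. Qed.

Lemma form_jac_ge0 x u : 0 <= form (jac f x) u u.
Proof.
have [->|/(@fpd x)/ltW //] := eqVneq u 0.
by rewrite /form trmx0 !mul0mx mxE.
Qed.

Lemma norm_dot_le u w : `|dot u w| <= n%:R * `|u| * `|w|.
Proof.
rewrite dotE; apply: le_trans (mx_coord_le _ _ _) _.
apply: le_trans (norm_mulmx_le _ _) _.
rewrite ler_wpM2r // ler_wpM2l //; apply: mx_norm_le => // i j.
by rewrite mxE; exact: mx_coord_le.
Qed.

(** The derivative of [r -> dot d (f (x + r *: d))] is the form of the Jacobian at [d], which is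
    nonnegative; the mean value theorem concludes. *)
Lemma monotone_on_rays x d s t : s <= t ->
  dot d (f (x + s *: d)) <= dot d (f (x + t *: d)).
Proof.
move=> st; pose p (r : R) := dot d (f (x + r *: d)).
have dp (r : R) : is_derive r 1 p (form (jac f (x + r *: d)) d d).
  have dc : is_derive r (1 : R) (fun r : R => f (x + r *: d)) (jac f (x + r *: d) *m d).
    exact/is_derive_line/is_derive_jac.
  have -> : p = fun r => (d^T *m f (x + r *: d)) 0 0.
    by apply/funext => r'; rewrite /p dotE.
  rewrite /form -mulmxA; apply: is_derive_coord.
  exact: is_derive_mulmx.
have [|c _ pE] := MVT_segment st (fun r _ => dp r).
  by apply: derivable_within_continuous => r _; case: (dp r).
by rewrite -subr_ge0 -/(p t) -/(p s) pE mulr_ge0 ?subr_ge0 // form_jac_ge0.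
Qed.

Let dotBr u v w : dot u (v - w) = dot u v - dot u w.
Proof. by rewrite !dotE mulmxBr addmxE oppmxE. Qed.

Let dotZl k u v : dot (k *: u) v = k * dot u v.
Proof. by rewrite !dotE linearZ /= -scalemxAl mxE. Qed.

(** The Jacobian at [x] contributes at least [c] times the squared norm, and the first-order
    remainder takes away at most half of it near [x]. *)
Lemma passive_locally_coercive x : exists c r, [/\ 0 < c, 0 < r &
  forall h, `|h| <= r -> c * `|h| ^+ 2 <= dot h (f (x + h) - f x)].
Proof.
have [c c0 cJ] := posdef_lower_bound (fT x) (@fpd x).
(* [N] bounds the factor [n] of [norm_dot_le] and stays positive when [n = 0]; the tolerance
   [c / (2 * N)] is what leaves [c / 2]. *)
pose N : R := n%:R + 1; have N0 : 0 < N by rewrite ltr_wpDl.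
have e0 : 0 < c / (2 * N) by rewrite divr_gt0 // mulr_gt0.
have [r r0 rf] := differentiable_jac_expansion (fdiff x) e0.
exists (c / 2), (r / 2); split; rewrite ?divr_gt0 // => h hr.
have /rf : `|h| < r.
  by rewrite (le_lt_trans hr) // ltr_pdivrMr // ltr_pMr // ltr1n.
set rho := _ - _ - _ => rho_le.
have -> : f (x + h) - f x = rho - - (jac f x *m h) by rewrite opprK subrK.
rewrite dotBr; have -> : dot h (- (jac f x *m h)) = - form (jac f x) h h.
  by rewrite dotE mulmxN oppmxE mulmxA.
have := cJ h; have: `|dot h rho| <= c / 2 * `|h| ^+ 2.
  apply: le_trans (norm_dot_le _ _) _.
  apply: (@le_trans _ _ (N * `|h| * (c / (2 * N) * `|h|))).
    by apply: ler_pM; rewrite ?mulr_ge0 // ler_wpM2r // lerDl.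
  by rewrite le_eqVlt; apply/orP; left; apply/eqP; field; rewrite gt_eqF.
by rewrite ler_norml => /andP[+ _]; lra.
Qed.

(** Within radius [r], coercivity and the bound on [dot] give the estimate after division by the
    norm of [y - x]. Farther away, [f y] stays at distance at least [d] from [f x], so that case is
    void. *)
Lemma passive_inverse_lipschitz x : exists K d, [/\ 0 < K, 0 < d &
  forall y, `|f y - f x| < d -> `|y - x| <= K * `|f y - f x|].
Proof.
have [c [r [c0 r0 cr]]] := passive_locally_coercive x.
pose N : R := n%:R + 1; have N0 : 0 < N by rewrite ltr_wpDl.
exists (N / c), (c * r / N); rewrite !divr_gt0 ?mulr_gt0 //; split=> // y.
have dot_le : dot (y - x) (f y - f x) <= N * `|y - x| * `|f y - f x|.
  apply: le_trans (ler_norm _) _; apply: le_trans (norm_dot_le _ _) _.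
  by rewrite ler_wpM2r // ler_wpM2r // lerDl.
have [->|yx] := eqVneq y x; first by rewrite !subrr normr0 mulr0.
have d0 : 0 < `|y - x| by rewrite normr_gt0 subr_eq0.
have [dr|dr] := leP `|y - x| r.
  move=> _; have := cr _ dr; rewrite [x + _]addrC subrK.
  move=> /le_trans/(_ dot_le).
  have -> : c * `|y - x| ^+ 2 = `|y - x| * (c * `|y - x|) by ring.
  have -> : N * `|y - x| * `|f y - f x| = `|y - x| * (N * `|f y - f x|) by ring.
  by rewrite ler_pM2l // => le1; rewrite mulrAC ler_pdivlMr // mulrC.
(* Beyond radius r, monotonicity along the ray reduces to the sphere. *)
pose s := r / `|y - x|; have s0 : 0 < s by rewrite divr_gt0.
have s1 : s <= 1 by rewrite ler_pdivrMr // mul1r ltW.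
have ns : `|s *: (y - x)| = r.
  by rewrite normrZ gtr0_norm // divfK // gt_eqF.
have := cr (s *: (y - x)); rewrite ns lexx => /(_ isT).
rewrite dotZl => cs.
have := monotone_on_rays x (y - x) s1; rewrite scale1r [x + (y - x)]addrC subrK => mono.
have : s * (c * r * `|y - x|) <= s * dot (y - x) (f y - f x).
  apply: (@le_trans _ _ (c * r ^+ 2)).
    by rewrite /s le_eqVlt; apply/orP; left; apply/eqP; field; rewrite gt_eqF.
  apply: le_trans cs _; rewrite ler_pM2l // !dotBr; lra.
rewrite ler_pM2l // => /le_trans/(_ dot_le).
rewrite [leRHS]mulrAC ler_pM2r // => lb ub.
by move: ub; rewrite ltr_pdivlMr // mulrC ltNge lb.
Qed.

Lemma jac_unit x : jac f x \in unitmx.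
Proof.
apply: definite_unit => u uJ; apply/eqP; apply: contraT => /(@fpd x).
by rewrite uJ mxE ltxx.
Qed.

(** With [y = finv (h *: v + b)], the error of the difference quotient is [J / h] applied to the
    first-order remainder of [f] at [x]. That remainder is small relative to [y - x], and the
    Lipschitz bound makes it small relative to [h]. *)
Lemma is_derive_passive_inverse b v :
  is_derive b v finv (invmx (jac f (finv b)) *m v).
Proof.
set x := finv b; set J := invmx _.
have [K [d [K0 d0 Kd]]] := passive_inverse_lipschitz x.
suff lim : h^-1 *: ((finv \o shift b) (h *: v) - finv b) @[h --> (0 : R)^'] --> J *m v.
  by split; [apply/cvg_ex; exists (J *m v) | exact/cvg_lim].
apply/cvgrPdist_le => e e0.
(* The product collects the constants of the final estimate; adding 1 makes [C] positive, so that
   the tolerance [e / C] is available. *)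
pose C := n%:R * `|J| * K * `|v| + 1.
have C0 : 0 < C by rewrite ltr_wpDl // !mulr_ge0 // ltW.
have [r r0 rf] := differentiable_jac_expansion (fdiff x) (divr_gt0 e0 C0).
have small (t : R) : 0 < t -> \forall h \near (0 : R)^', `|h| * `|v| < t.
  move=> t0; have v1 : 0 < `|v| + 1 by rewrite ltr_wpDl.
  near=> h; apply: (@le_lt_trans _ _ (`|h| * (`|v| + 1))).
    by rewrite ler_wpM2l // lerDl.
  rewrite -ltr_pdivlMr //; near: h; apply: dnbhs0_lt; exact: divr_gt0.
near=> h.
have h0 : h != 0 by near: h; exact: nbhs_dnbhs_neq.
have hd : `|h| * `|v| < d by near: h; exact: small.
have hr : `|h| * `|v| < r / K by near: h; apply: small; exact: divr_gt0.
pose y := finv (h *: v + b).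
have fyx : f y - f x = h *: v by rewrite /y /x !fK addrK.
have yx : `|y - x| <= K * (`|h| * `|v|).
  by rewrite -normrZ -fyx; apply: Kd; rewrite fyx normrZ.
have : `|y - x| < r by rewrite (le_lt_trans yx) // mulrC -ltr_pdivlMr.
move=> /rf; rewrite [x + _]addrC subrK fyx => rho_le.
rewrite /= -/y -/x.
have -> : J *m v - h^-1 *: (y - x) = h^-1 *: (J *m (h *: v - jac f x *m (y - x))).
  rewrite mulmxBr mulmxA /J mulVmx ?jac_unit // mul1mx -scalemxAr [RHS]scalerBr.
  by rewrite scalerA mulVf // scale1r.
rewrite normrZ normfV ler_pdivrMl ?normr_gt0 //.
apply: le_trans (norm_mulmx_le _ _) _.
apply: (@le_trans _ _ (n%:R * `|J| * (e / C * (K * (`|h| * `|v|))))).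
  rewrite ler_wpM2l ?mulr_ge0 //; apply: le_trans rho_le _.
  by rewrite ler_wpM2l // divr_ge0 // ltW.
have -> : n%:R * `|J| * (e / C * (K * (`|h| * `|v|))) =
    `|h| * e * ((C - 1) / C).
  by rewrite /C addrK; ring.
rewrite ler_piMr ?mulr_ge0 ?(ltW e0) // ler_pdivrMr // mul1r.
by rewrite lerBlDr lerDl.
Unshelve. all: by end_near. Qed.

(** By Cramer's rule only the entries of [jac f (finv y)] matter. [finv] has been given directional
    derivatives only, so the chain rule is applied along the line through [a] in direction [b],
    where derivable and differentiable agree. *)
Lemma derivable_passive_inverse2 (a b v : 'cV[R]_n) : Ck 2 setT f ->
  derivable (fun y => invmx (jac f (finv y)) *m v) a b.
Proof.
case=> _ f2; have fd2 (w y : 'cV[R]_n) : differentiable ('D_w f) y by case: (f2 w) => + _; apply.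
suff /derivable_mxP iJ : derivable (fun y => invmx (jac f (finv y))) a b.
  apply/derivable_mxP => i j; under eq_fun do rewrite mxE.
  by apply: derivable_bigsum => k; apply: derivableM => //; exact: derivable_cst.
apply: derivable_invmx => [y|]; first exact: jac_unit.
apply/derivable_mxP => i j; under eq_fun do rewrite mxE.
have [dl _] : is_derive (0 : R) 1 (fun s : R => finv (a + s *: b))
    (invmx (jac f (finv a)) *m b).
  apply: is_derive_line; rewrite scale0r addr0; exact: is_derive_passive_inverse.
apply/derivable1P; set D := 'D_(delta_mx j 0) f.
suff dc : derivable (fun s : R => D (finv (a + s *: b))) 0 1.
  under eq_fun do rewrite addrC.
  by move/derivable_mxP: dc; apply.
apply/derivable1_diffP; apply: differentiable_comp (fd2 _ _).
exact/derivable1_diffP.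
Qed.

End PassiveInverse.

(** * Derivatives of the rows *)

Section RowDerivatives.
Variables (R : realType) (N nc nr nl nv ni : nat).
Variables (AC : 'M[R]_(N, nc)) (AR : 'M[R]_(N, nr)) (AL : 'M[R]_(N, nl))
  (AV : 'M[R]_(N, nv)) (AI : 'M[R]_(N, ni)).
Variables (uC : 'cV[R]_nc -> 'cV[R]_nc) (iL : 'cV[R]_nl -> 'cV[R]_nl)
  (g : 'cV[R]_nr -> 'cV[R]_nr).
Variables (DC : 'cV[R]_nc -> 'M[R]_nc) (DL : 'cV[R]_nl -> 'M[R]_nl)
  (Dg : 'cV[R]_nr -> 'M[R]_nr).
Implicit Types (q d : 'cV[R]_nc) (p : 'cV[R]_nl) (e : 'cV[R]_N) (j : 'cV[R]_nv)
  (i : 'cV[R]_ni).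

(** The term [D^2 f (a) [b, b]] of the chain rule, with [Df] in the role of the Jacobian of [f]. *)
Definition second_derivative n (Df : 'cV[R]_n -> 'M[R]_n) (a b : 'cV[R]_n) :=
  'D_b (fun x => Df x *m b) a.

Definition twice_derivable n (Df : 'cV[R]_n -> 'M[R]_n) :=
  forall a b v : 'cV[R]_n, derivable (fun x => Df x *m v) a b.

(** The argument [d] is the current through the capacitances: the derivative of the charge in one
    system, the unknown [j_C] in the other. This lets both share the residuals and their
    derivatives. *)
Definition kcl0 d p j e i : 'cV[R]_N :=
  AC *m d + AL *m iL p + AV *m j + AR *m g (AR^T *m e) + AI *m i.

Definition kcl1 d1 p0 p1 j1 e0 e1 i1 : 'cV[R]_N :=
  AC *m d1 + AL *m (DL p0 *m p1) + AV *m j1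
    + AR *m (Dg (AR^T *m e0) *m (AR^T *m e1)) + AI *m i1.

Definition kcl2 d2 p0 p1 p2 j2 e0 e1 e2 i2 : 'cV[R]_N :=
  AC *m d2 + AL *m (DL p0 *m p2 + second_derivative DL p0 p1) + AV *m j2
    + AR *m (Dg (AR^T *m e0) *m (AR^T *m e2)
             + second_derivative Dg (AR^T *m e0) (AR^T *m e1)) + AI *m i2.

Lemma is_derive_affine (V : normedModType R) (a b : V) :
  is_derive (0 : R) 1 (fun s : R => a + s *: b) b.
Proof. exact: (@is_derive_line _ _ _ id _ a b 0). Qed.

Lemma is_derive_along n m (f : 'cV[R]_n -> 'cV[R]_m) (a b : 'cV[R]_n) df :
  is_derive a b f df -> is_derive (0 : R) 1 (fun s : R => f (a + s *: b)) df.
Proof. by move=> fa; apply: is_derive_line; rewrite scale0r addr0. Qed.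

(** [twice_derivable] speaks of a fixed vector, so the moving vector [b + s *: c] is split. The part
    with the factor [s] has derivative [Df a *m c] at 0, the other part gives the second
    derivative. *)
Lemma is_derive_velocity n (Df : 'cV[R]_n -> 'M[R]_n) (a b c : 'cV[R]_n) :
  twice_derivable Df ->
  is_derive (0 : R) 1 (fun s : R => Df (a + s *: b) *m (b + s *: c))
    (Df a *m c + second_derivative Df a b).
Proof.
move=> dDf; have dir (v : 'cV[R]_n) : is_derive (0 : R) 1
    (fun s : R => Df (a + s *: b) *m v) ('D_b (fun x => Df x *m v) a).
  apply: (@is_derive_along _ _ (fun x => Df x *m v)); exact: derivableP.
have -> : (fun s : R => Df (a + s *: b) *m (b + s *: c)) =
    (fun s : R => s *: (Df (a + s *: b) *m c)) + (fun s : R => Df (a + s *: b) *m b).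
  by apply/funext => s; rewrite fctE mulmxDr -scalemxAr addrC.
apply: is_deriveD (dir b); apply: is_derive_mx => k l.
under eq_fun do rewrite mxE.
have := is_deriveM (@is_derive_id _ _ (0 : R) 1) (is_derive_coord k l (dir c)).
by move/is_derive_eq; apply; rewrite /= !scale0r add0r addr0 [_ *: 1]mulr1.
Qed.

Hypotheses (dC : forall a b, is_derive a b uC (DC a *m b))
  (dL : forall a b, is_derive a b iL (DL a *m b))
  (dg : forall a b, is_derive a b g (Dg a *m b)).

Lemma is_derive_kcl0 d0 d1 p0 p1 j0 j1 e0 e1 (i : R -> 'cV_ni) i1 :
  is_derive (0 : R) 1 i i1 ->
  is_derive (0 : R) 1 (fun s : R => kcl0 (d0 + s *: d1) (p0 + s *: p1)
    (j0 + s *: j1) (e0 + s *: e1) (i s)) (kcl1 d1 p0 p1 j1 e0 e1 i1).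
Proof.
move=> di; rewrite /kcl0 /kcl1.
do !apply: is_deriveD; apply: is_derive_mulmx => //.
- exact: is_derive_affine.
- exact: is_derive_along.
- exact: is_derive_affine.
- under eq_fun do rewrite mulmxDr -scalemxAr.
  exact: is_derive_along.
Qed.

Lemma is_derive_kcl1 d1 d2 p0 p1 p2 j1 j2 e0 e1 e2 (i : R -> 'cV_ni) i2 :
  twice_derivable DL -> twice_derivable Dg -> is_derive (0 : R) 1 i i2 ->
  is_derive (0 : R) 1 (fun s : R => kcl1 (d1 + s *: d2) (p0 + s *: p1)
    (p1 + s *: p2) (j1 + s *: j2) (e0 + s *: e1) (e1 + s *: e2) (i s))
    (kcl2 d2 p0 p1 p2 j2 e0 e1 e2 i2).
Proof.
move=> ddL ddg di; rewrite /kcl1 /kcl2.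
do !apply: is_deriveD; apply: is_derive_mulmx => //.
- exact: is_derive_affine.
- exact: is_derive_velocity.
- exact: is_derive_affine.
- under eq_fun do rewrite ![AR^T *m (_ + _)]mulmxDr -!scalemxAr.
  exact: is_derive_velocity.
Qed.

Lemma is_derive_capacitor0 e0 e1 q0 q1 :
  is_derive (0 : R) 1 (fun s : R => AC^T *m (e0 + s *: e1) - uC (q0 + s *: q1))
    (AC^T *m e1 - DC q0 *m q1).
Proof.
apply: is_deriveB; last exact: is_derive_along.
by apply: is_derive_mulmx; exact: is_derive_affine.
Qed.

Lemma is_derive_capacitor1 e1 e2 q0 q1 q2 : twice_derivable DC ->
  is_derive (0 : R) 1
    (fun s : R => AC^T *m (e1 + s *: e2) - DC (q0 + s *: q1) *m (q1 + s *: q2))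
    (AC^T *m e2 - (DC q0 *m q2 + second_derivative DC q0 q1)).
Proof.
move=> ddC; apply: is_deriveB; last exact: is_derive_velocity.
by apply: is_derive_mulmx; exact: is_derive_affine.
Qed.

Lemma is_derive_inductor p1 p2 e0 e1 :
  is_derive (0 : R) 1 (fun s : R => (p1 + s *: p2) - AL^T *m (e0 + s *: e1))
    (p2 - AL^T *m e1).
Proof.
apply: is_deriveB; first exact: is_derive_affine.
by apply: is_derive_mulmx; exact: is_derive_affine.
Qed.

Lemma is_derive_source (v : R -> 'cV_nv) v1 e0 e1 : is_derive (0 : R) 1 v v1 ->
  is_derive (0 : R) 1 (fun s : R => v s - AV^T *m (e0 + s *: e1)) (v1 - AV^T *m e1).
Proof.
move=> dv; apply: is_deriveB => //.
by apply: is_derive_mulmx; exact: is_derive_affine.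
Qed.

End RowDerivatives.

(** * Derivative arrays *)

Section BlockProducts.
Variable R : realType.

Lemma mul_row4 m a b c d (A : 'M[R]_(m, a)) (B : 'M[R]_(m, b)) (C : 'M[R]_(m, c))
    (D : 'M[R]_(m, d)) (x : 'cV[R]_(a + (b + (c + d)))) :
  row4 A B C D *m x = A *m usubmx x + (B *m usubmx (dsubmx x)
    + (C *m usubmx (dsubmx (dsubmx x)) + D *m dsubmx (dsubmx (dsubmx x)))).
Proof.
rewrite -{1}[x]vsubmxK -{1}[dsubmx x]vsubmxK -{1}[dsubmx (dsubmx x)]vsubmxK.
by rewrite /row4 !mul_row_col.
Qed.

Lemma mul_row5 m a b c d e (A : 'M[R]_(m, a)) (B : 'M[R]_(m, b)) (C : 'M[R]_(m, c))
    (D : 'M[R]_(m, d)) (E : 'M[R]_(m, e)) (x : 'cV[R]_(a + (b + (c + (d + e))))) :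
  row5 A B C D E *m x = A *m usubmx x + (B *m usubmx (dsubmx x)
    + (C *m usubmx (dsubmx (dsubmx x)) + (D *m usubmx (dsubmx (dsubmx (dsubmx x)))
    + E *m dsubmx (dsubmx (dsubmx (dsubmx x)))))).
Proof. by rewrite /row5 -{1}[x]vsubmxK mul_row_col mul_row4. Qed.

Lemma mul_col4 m a b c d (A : 'M[R]_(a, m)) (B : 'M[R]_(b, m)) (C : 'M[R]_(c, m))
    (D : 'M[R]_(d, m)) (x : 'cV[R]_m) :
  col4 A B C D *m x = col4 (A *m x) (B *m x) (C *m x) (D *m x).
Proof. by rewrite /col4 !mul_col_mx. Qed.

Lemma add_col4 a b c d (A A' : 'cV[R]_a) (B B' : 'cV[R]_b) (C C' : 'cV[R]_c)
    (D D' : 'cV[R]_d) :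
  col4 A B C D + col4 A' B' C' D' = col4 (A + A') (B + B') (C + C') (D + D').
Proof. by rewrite /col4 !add_col_mx. Qed.

Lemma opp_col4 a b c d (A : 'cV[R]_a) (B : 'cV[R]_b) (C : 'cV[R]_c) (D : 'cV[R]_d) :
  - col4 A B C D = col4 (- A) (- B) (- C) (- D).
Proof. by rewrite /col4 !opp_col_mx. Qed.

Lemma col4_eq0 a b c d (A : 'cV[R]_a) (B : 'cV[R]_b) (C : 'cV[R]_c) (D : 'cV[R]_d) :
  col4 A B C D = 0 <-> [/\ A = 0, B = 0, C = 0 & D = 0].
Proof.
split=> [/eqP|[-> -> -> ->]]; last by rewrite /col4 !col_mx0.
by rewrite /col4 !col_mx_eq0 => /and4P[/eqP -> /eqP -> /eqP -> /eqP ->].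
Qed.

Lemma is_derive_col4 a b c d (A : R -> 'cV[R]_a) (B : R -> 'cV[R]_b)
    (C : R -> 'cV[R]_c) (D : R -> 'cV[R]_d) A' B' C' D' (s : R) :
  is_derive s (1 : R) A A' -> is_derive s (1 : R) B B' ->
  is_derive s (1 : R) C C' -> is_derive s (1 : R) D D' ->
  is_derive s (1 : R) (fun r => col4 (A r) (B r) (C r) (D r)) (col4 A' B' C' D').
Proof. by move=> *; rewrite /col4; do !apply: is_derive_col_mx. Qed.

Lemma mul_col5 m a b c d e (A : 'M[R]_(a, m)) (B : 'M[R]_(b, m)) (C : 'M[R]_(c, m))
    (D : 'M[R]_(d, m)) (E : 'M[R]_(e, m)) (x : 'cV[R]_m) :
  col5 A B C D E *m x = col5 (A *m x) (B *m x) (C *m x) (D *m x) (E *m x).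
Proof. by rewrite /col5 mul_col_mx mul_col4. Qed.

Lemma add_col5 a b c d e (A A' : 'cV[R]_a) (B B' : 'cV[R]_b) (C C' : 'cV[R]_c)
    (D D' : 'cV[R]_d) (E E' : 'cV[R]_e) :
  col5 A B C D E + col5 A' B' C' D' E' =
  col5 (A + A') (B + B') (C + C') (D + D') (E + E').
Proof. by rewrite /col5 add_col_mx add_col4. Qed.

Lemma opp_col5 a b c d e (A : 'cV[R]_a) (B : 'cV[R]_b) (C : 'cV[R]_c) (D : 'cV[R]_d)
    (E : 'cV[R]_e) :
  - col5 A B C D E = col5 (- A) (- B) (- C) (- D) (- E).
Proof. by rewrite /col5 opp_col_mx opp_col4. Qed.

Lemma col5_eq0 a b c d e (A : 'cV[R]_a) (B : 'cV[R]_b) (C : 'cV[R]_c) (D : 'cV[R]_d)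
    (E : 'cV[R]_e) :
  col5 A B C D E = 0 <-> A = 0 /\ [/\ B = 0, C = 0, D = 0 & E = 0].
Proof.
rewrite -col4_eq0; split=> [/eqP|[-> E0]]; last by rewrite /col5 E0 col_mx0.
by rewrite /col5 col_mx_eq0 => /andP[/eqP -> /eqP ->].
Qed.

Lemma col5_proj a b c d e (A : 'cV[R]_a) (B : 'cV[R]_b) (C : 'cV[R]_c) (D : 'cV[R]_d)
    (E : 'cV[R]_e) (x := col5 A B C D E) :
  (usubmx x = A) * (usubmx (dsubmx x) = B) * (usubmx (dsubmx (dsubmx x)) = C) *
  (usubmx (dsubmx (dsubmx (dsubmx x))) = D) * (dsubmx (dsubmx (dsubmx (dsubmx x))) = E).
Proof. by rewrite /x /col5 /col4 !(col_mxKu, col_mxKd). Qed.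

Lemma col5_congr a b c d e (A A' : 'cV[R]_a) (B B' : 'cV[R]_b) (C C' : 'cV[R]_c)
    (D D' : 'cV[R]_d) (E E' : 'cV[R]_e) :
  A = A' -> B = B' -> C = C' -> D = D' -> E = E' ->
  col5 A B C D E = col5 A' B' C' D' E'.
Proof. by move=> -> -> -> -> ->. Qed.

Lemma is_derive_col5 a b c d e (A : R -> 'cV[R]_a) (B : R -> 'cV[R]_b)
    (C : R -> 'cV[R]_c) (D : R -> 'cV[R]_d) (E : R -> 'cV[R]_e) A' B' C' D' E' (s : R) :
  is_derive s (1 : R) A A' -> is_derive s (1 : R) B B' ->
  is_derive s (1 : R) C C' -> is_derive s (1 : R) D D' -> is_derive s (1 : R) E E' ->
  is_derive s (1 : R) (fun r => col5 (A r) (B r) (C r) (D r) (E r))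
    (col5 A' B' C' D' E').
Proof. by move=> *; apply: is_derive_col_mx => //; exact: is_derive_col4. Qed.

Definition block1 a b c d (x : 'cV[R]_(a + (b + (c + d)))) : 'cV_a := usubmx x.
Definition block2 a b c d (x : 'cV[R]_(a + (b + (c + d)))) : 'cV_b := usubmx (dsubmx x).
Definition block3 a b c d (x : 'cV[R]_(a + (b + (c + d)))) : 'cV_c :=
  usubmx (dsubmx (dsubmx x)).
Definition block4 a b c d (x : 'cV[R]_(a + (b + (c + d)))) : 'cV_d :=
  dsubmx (dsubmx (dsubmx x)).

Lemma block_affine a b c d (x y : 'cV[R]_(a + (b + (c + d)))) (s : R) :
  [/\ block1 (x + s *: y) = block1 x + s *: block1 y,
      block2 (x + s *: y) = block2 x + s *: block2 y,
      block3 (x + s *: y) = block3 x + s *: block3 y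
    & block4 (x + s *: y) = block4 x + s *: block4 y].
Proof. by split; rewrite /block1 /block2 /block3 /block4 !(linearD, linearZ). Qed.

Lemma block_col4 a b c d (A : 'cV[R]_a) (B : 'cV[R]_b) (C : 'cV[R]_c) (D : 'cV[R]_d) :
  [/\ block1 (col4 A B C D) = A, block2 (col4 A B C D) = B,
      block3 (col4 A B C D) = C & block4 (col4 A B C D) = D].
Proof.
by rewrite /block1 /block2 /block3 /block4 /col4 !(col_mxKu, col_mxKd).
Qed.

Lemma col4_blocks a b c d (x : 'cV[R]_(a + (b + (c + d)))) :
  x = col4 (block1 x) (block2 x) (block3 x) (block4 x).
Proof. by rewrite /col4 !vsubmxK. Qed.

Lemma block_ext a b c d (x y : 'cV[R]_(a + (b + (c + d)))) :
  block1 x = block1 y -> block2 x = block2 y -> block3 x = block3 y ->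
  block4 x = block4 y -> x = y.
Proof. by move=> E1 E2 E3 E4; rewrite [LHS]col4_blocks E1 E2 E3 E4 -col4_blocks. Qed.

End BlockProducts.

Section DerivativeArrays.
Variables (R : realType) (G : circuit).
Variables (qinv : 'cV[R]_(nC G) -> 'cV[R]_(nC G))
  (phiinv : 'cV[R]_(nL G) -> 'cV[R]_(nL G))
  (g : 'cV[R]_(nR G) -> 'cV[R]_(nR G)).
Variables (isrc : R -> 'cV[R]_(nI G)) (vsrc : R -> 'cV[R]_(nV G)).
Variables (DC : 'cV[R]_(nC G) -> 'M[R]_(nC G)) (DL : 'cV[R]_(nL G) -> 'M[R]_(nL G))
  (Dg : 'cV[R]_(nR G) -> 'M[R]_(nR G)).

Local Notation A_C := (incidence G R Capacitance).
Local Notation A_R := (incidence G R Resistance).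
Local Notation A_L := (incidence G R Inductance).
Local Notation A_V := (incidence G R VoltageSource).
Local Notation A_I := (incidence G R CurrentSource).

Local Notation kcl0 := (kcl0 A_C A_R A_L A_V A_I phiinv g).
Local Notation kcl1 := (kcl1 A_C A_R A_L A_V A_I DL Dg).
Local Notation kcl2 := (kcl2 A_C A_R A_L A_V A_I DL Dg).

Lemma charge_DAE_rows (xdot x : 'cV[R]_(charge_dim G)) t :
  charge_DAE qinv phiinv g isrc vsrc xdot x t =
  col4 (kcl0 (block1 xdot) (block2 x) (block4 x) (block3 x) (isrc t))
       (block2 xdot - A_L^T *m block3 x)
       (A_C^T *m block3 x - qinv (block1 x))
       (vsrc t - A_V^T *m block3 x).
Proof.
rewrite /charge_DAE !mul_col4 !mul_row4 !mul_row_col.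
rewrite !(opp_col4, add_col4) /kcl0 !(mul0mx, mulNmx, mul1mx, add0r, addr0, oppr0).
have [-> -> -> ->] : [/\ usubmx x = block1 x, usubmx (dsubmx x) = block2 x,
  usubmx (dsubmx (dsubmx x)) = block3 x & dsubmx (dsubmx (dsubmx x)) = block4 x] by [].
have -> : usubmx xdot = block1 xdot by [].
have -> : usubmx (dsubmx xdot) = block2 xdot by [].
congr col4; rewrite ?opprK // /col4 ?(col_mxKu, col_mxKd) //.
  apply/matrixP => a b; rewrite !(addmxE, oppmxE); ring.
by rewrite opprB.
Qed.

Lemma derivative_array_S n k (F : 'cV[R]_n -> 'cV[R]_n -> R -> 'cV[R]_k) m y t :
  derivative_array F m.+1 y t =
  'D_1 (fun s : R => derivative_array F m (fun i => y i + s *: y i.+1) (t + s)) 0.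
Proof. by rewrite /derivative_array iterS /total_derivative derive1E. Qed.

Lemma is_derive_shift_time n (s : R -> 'cV[R]_n) (t : R) : differentiable s t ->
  is_derive (0 : R) 1 (fun r : R => s (t + r)) ('D_1 s t).
Proof.
move=> ds; have E : (fun r : R => s (t + r)) = (fun r : R => s (t + r *: 1)).
  by apply/funext => r; rewrite [r *: 1]mulr1.
rewrite E; apply: is_derive_line; rewrite scale0r addr0.
exact/derivableP/diff_derivable.
Qed.

Lemma near_translate (J : set R) (t : R) : open J -> J t ->
  \forall s \near (0 : R), J (t + s).
Proof.
move=> Jo Jt; have : {for (0 : R), continuous (fun s : R => t + s)}.
  by apply: continuousD; [exact: cvg_cst|exact: cvg_id].
by apply; rewrite addr0; exact: open_nbhs_nbhs.
Qed.

Hypotheses (dC : forall a b, is_derive a b qinv (DC a *m b))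
  (dL : forall a b, is_derive a b phiinv (DL a *m b))
  (dg : forall a b, is_derive a b g (Dg a *m b)).

Local Notation charge_array := (derivative_array (charge_DAE qinv phiinv g isrc vsrc)).

Lemma charge_array1 y t : differentiable isrc t -> differentiable vsrc t ->
  charge_array 1 y t =
  col4 (kcl1 (block1 (y 2)) (block2 (y 0)) (block2 (y 1)) (block4 (y 1))
          (block3 (y 0)) (block3 (y 1)) ('D_1 isrc t))
       (block2 (y 2) - A_L^T *m block3 (y 1))
       (A_C^T *m block3 (y 1) - DC (block1 (y 0)) *m block1 (y 1))
       ('D_1 vsrc t - A_V^T *m block3 (y 1)).
Proof.
move=> di dv; rewrite derivative_array_S.
under eq_fun => s.
  rewrite /derivative_array /= charge_DAE_rows.
  have [-> -> -> ->] := block_affine (y 0) (y 1) s.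
  have [-> -> _ _] := block_affine (y 1) (y 2) s.
  over.
apply: derive_val; apply: is_derive_col4.
- exact/is_derive_kcl0/is_derive_shift_time.
- exact: is_derive_inductor.
- exact: is_derive_capacitor0.
- exact/is_derive_source/is_derive_shift_time.
Qed.

(** The closed form of the order 1 row holds at all times in [J], hence near [t] as [J] is open, and
    the derivative at [t] sees only such a neighbourhood. *)
Lemma charge_array2 (J : set R) y t : open J -> J t ->
  (forall s, J s -> differentiable isrc s) ->
  (forall s, J s -> differentiable vsrc s) ->
  differentiable ('D_1 isrc) t -> differentiable ('D_1 vsrc) t ->
  twice_derivable DC -> twice_derivable DL -> twice_derivable Dg ->
  charge_array 2 y t =
  col4 (kcl2 (block1 (y 3)) (block2 (y 0)) (block2 (y 1)) (block2 (y 2))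
          (block4 (y 2)) (block3 (y 0)) (block3 (y 1)) (block3 (y 2))
          ('D_1 ('D_1 isrc) t))
       (block2 (y 3) - A_L^T *m block3 (y 2))
       (A_C^T *m block3 (y 2) - (DC (block1 (y 0)) *m block1 (y 2)
          + second_derivative DC (block1 (y 0)) (block1 (y 1))))
       ('D_1 ('D_1 vsrc) t - A_V^T *m block3 (y 2)).
Proof.
move=> Jo Jt di dv di' dv' ddC ddL ddg; rewrite derivative_array_S.
have nearJ := near_translate Jo Jt.
rewrite (near_eq_derive (g := fun s : R =>
  col4 (kcl1 (block1 (y 2) + s *: block1 (y 3)) (block2 (y 0) + s *: block2 (y 1))
          (block2 (y 1) + s *: block2 (y 2)) (block4 (y 1) + s *: block4 (y 2))
          (block3 (y 0) + s *: block3 (y 1)) (block3 (y 1) + s *: block3 (y 2))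
          ('D_1 isrc (t + s)))
       ((block2 (y 2) + s *: block2 (y 3))
          - A_L^T *m (block3 (y 1) + s *: block3 (y 2)))
       (A_C^T *m (block3 (y 1) + s *: block3 (y 2))
          - DC (block1 (y 0) + s *: block1 (y 1))
            *m (block1 (y 1) + s *: block1 (y 2)))
       ('D_1 vsrc (t + s) - A_V^T *m (block3 (y 1) + s *: block3 (y 2))))).
  apply: derive_val; apply: is_derive_col4.
  - exact: (is_derive_kcl1 A_C A_R A_L A_V A_I (block1 (y 2)) (block1 (y 3))
      (block2 (y 0)) (block2 (y 1)) (block2 (y 2)) (block4 (y 1)) (block4 (y 2))
      (block3 (y 0)) (block3 (y 1)) (block3 (y 2)) ddL ddg (is_derive_shift_time di')).
  - exact: is_derive_inductor.
  - exact: is_derive_capacitor1 ddC.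
  - exact: is_derive_source (is_derive_shift_time dv').
near=> s; rewrite charge_array1; [|apply: di; near: s; exact: nearJ
  |apply: dv; near: s; exact: nearJ].
have [-> -> -> _] := block_affine (y 0) (y 1) s.
have [-> -> -> ->] := block_affine (y 1) (y 2) s.
by have [-> -> _ _] := block_affine (y 2) (y 3) s.
Unshelve. all: by end_near. Qed.

Local Notation tailx x := (dsubmx x : 'cV[R]_(nC G + (nC G + (nL G + nV G)))).
Local Notation headx x := (usubmx x : 'cV[R]_(n_node G)).

Lemma extended_DAE_rows (xdot x : 'cV[R]_(extended_dim G)) t :
  extended_DAE qinv phiinv g isrc vsrc xdot x t =
  col5 (kcl0 (block1 (tailx x)) (block3 (tailx x)) (block4 (tailx x)) (headx x) (isrc t))
       (- (A_C^T *m headx x - qinv (block2 (tailx x))))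
       (block2 (tailx xdot) - block1 (tailx x))
       (block3 (tailx xdot) - A_L^T *m headx x)
       (vsrc t - A_V^T *m headx x).
Proof.
rewrite /extended_DAE !mul_col5 !mul_row5 !mul_row_col.
rewrite !(opp_col5, add_col5) /kcl0 !(mul0mx, mulNmx, mul1mx, add0r, addr0, oppr0).
rewrite !col5_proj /block1 /block2 /block3 /block4; apply: col5_congr.
- by rewrite !opprD !opprK addrA.
- by [].
- by [].
- by [].
- by rewrite opprB.
Qed.

Local Notation extended_array := (derivative_array (extended_DAE qinv phiinv g isrc vsrc)).

Lemma head_affine (x y : 'cV[R]_(extended_dim G)) (s : R) :
  headx (x + s *: y) = headx x + s *: headx y /\
  tailx (x + s *: y) = tailx x + s *: tailx y.
Proof. by rewrite !(linearD, linearZ). Qed.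

Lemma extended_array1 y t : differentiable isrc t -> differentiable vsrc t ->
  extended_array 1 y t =
  col5 (kcl1 (block1 (tailx (y 1))) (block3 (tailx (y 0))) (block3 (tailx (y 1)))
          (block4 (tailx (y 1))) (headx (y 0)) (headx (y 1)) ('D_1 isrc t))
       (- (A_C^T *m headx (y 1) - DC (block2 (tailx (y 0))) *m block2 (tailx (y 1))))
       (block2 (tailx (y 2)) - block1 (tailx (y 1)))
       (block3 (tailx (y 2)) - A_L^T *m headx (y 1))
       ('D_1 vsrc t - A_V^T *m headx (y 1)).
Proof.
move=> di dv; rewrite derivative_array_S.
under eq_fun => s.
  rewrite /derivative_array /= extended_DAE_rows.
  have [-> ->] := head_affine (y 0) (y 1) s.
  have [_ ->] := head_affine (y 1) (y 2) s.
  have [-> -> -> ->] := block_affine (tailx (y 0)) (tailx (y 1)) s.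
  have [_ -> -> _] := block_affine (tailx (y 1)) (tailx (y 2)) s.
  over.
apply: derive_val; apply: is_derive_col5.
- exact/is_derive_kcl0/is_derive_shift_time.
- apply: is_deriveN; exact: is_derive_capacitor0.
- by apply: is_deriveB; exact: is_derive_affine.
- exact: is_derive_inductor.
- exact/is_derive_source/is_derive_shift_time.
Qed.

Lemma extended_array2 (J : set R) y t : open J -> J t ->
  (forall s, J s -> differentiable isrc s) ->
  (forall s, J s -> differentiable vsrc s) ->
  differentiable ('D_1 isrc) t -> differentiable ('D_1 vsrc) t ->
  twice_derivable DC -> twice_derivable DL -> twice_derivable Dg ->
  extended_array 2 y t =
  col5 (kcl2 (block1 (tailx (y 2))) (block3 (tailx (y 0))) (block3 (tailx (y 1)))
          (block3 (tailx (y 2))) (block4 (tailx (y 2))) (headx (y 0)) (headx (y 1))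
          (headx (y 2)) ('D_1 ('D_1 isrc) t))
       (- (A_C^T *m headx (y 2) - (DC (block2 (tailx (y 0))) *m block2 (tailx (y 2))
          + second_derivative DC (block2 (tailx (y 0))) (block2 (tailx (y 1))))))
       (block2 (tailx (y 3)) - block1 (tailx (y 2)))
       (block3 (tailx (y 3)) - A_L^T *m headx (y 2))
       ('D_1 ('D_1 vsrc) t - A_V^T *m headx (y 2)).
Proof.
move=> Jo Jt di dv di' dv' ddC ddL ddg; rewrite derivative_array_S.
have nearJ := near_translate Jo Jt.
pose d k := block1 (tailx (y k)); pose q k := block2 (tailx (y k)).
pose p k := block3 (tailx (y k)); pose j k := block4 (tailx (y k)).
pose e k := headx (y k).
rewrite (near_eq_derive (g := fun s : R =>
  col5 (kcl1 (d 1 + s *: d 2) (p 0 + s *: p 1) (p 1 + s *: p 2) (j 1 + s *: j 2)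
          (e 0 + s *: e 1) (e 1 + s *: e 2) ('D_1 isrc (t + s)))
       (- (A_C^T *m (e 1 + s *: e 2)
          - DC (q 0 + s *: q 1) *m (q 1 + s *: q 2)))
       ((q 2 + s *: q 3) - (d 1 + s *: d 2))
       ((p 2 + s *: p 3) - A_L^T *m (e 1 + s *: e 2))
       ('D_1 vsrc (t + s) - A_V^T *m (e 1 + s *: e 2)))).
  apply: derive_val; apply: is_derive_col5.
  - exact: (is_derive_kcl1 A_C A_R A_L A_V A_I (d 1) (d 2) (p 0) (p 1) (p 2)
      (j 1) (j 2) (e 0) (e 1) (e 2) ddL ddg (is_derive_shift_time di')).
  - apply: is_deriveN; exact: is_derive_capacitor1 ddC.
  - by apply: is_deriveB; exact: is_derive_affine.
  - exact: is_derive_inductor.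
  - exact: is_derive_source (is_derive_shift_time dv').
near=> s; rewrite extended_array1; [|apply: di; near: s; exact: nearJ
  |apply: dv; near: s; exact: nearJ].
have [-> ->] := head_affine (y 0) (y 1) s.
have [-> ->] := head_affine (y 1) (y 2) s.
have [_ ->] := head_affine (y 2) (y 3) s.
have [_ -> -> _] := block_affine (tailx (y 0)) (tailx (y 1)) s.
have [-> -> -> ->] := block_affine (tailx (y 1)) (tailx (y 2)) s.
by have [_ -> -> _] := block_affine (tailx (y 2)) (tailx (y 3)) s.
Unshelve. all: by end_near. Qed.

End DerivativeArrays.

(** * Differentiation index *)

Section IndexBasics.
Variables (R : realType) (n k : nat) (U V : set 'cV[R]_n) (I : interval R).
Variable F : 'cV[R]_n -> 'cV[R]_n -> R -> 'cV[R]_k.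

Lemma array_solvable_le mu nu xdot x t : (mu <= nu)%N ->
  array_solvable U F nu xdot x t -> array_solvable U F mu xdot x t.
Proof.
move=> mn [Ux [y [y0 y1 Uy Fy]]]; split=> //; exists y; split=> // i.
  by case/andP=> i1 im; apply: Uy; rewrite i1 (leq_trans im).
by move=> im; apply: Fy; exact: leq_trans mn.
Qed.

Lemma consistent_le mu nu x t : (mu <= nu)%N ->
  consistent U V I F nu x t -> consistent U V I F mu x t.
Proof.
move=> mn [Vx tI [xdot sol]]; split=> //; exists xdot.
exact: array_solvable_le sol.
Qed.

Lemma not_determines_of_two nu x t xdot xdot' : consistent U V I F nu x t ->
  array_solvable U F nu xdot x t -> array_solvable U F nu xdot' x t ->
  xdot <> xdot' -> ~ determines_xdot U V I F nu.
Proof.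
move=> con sol sol' neq det; have [z [_ zu]] := det x t con.
by apply: neq; rewrite -(zu _ sol) (zu _ sol').
Qed.

(** Forward, the index supplies a point consistent at order 1, where the failure of [cond] would
    contradict uniqueness. Backward, the point consistent at order 0 is lifted to order 1. *)
Lemma index1_iff (cond : Prop) :
  (forall x t, consistent U V I F 0 x t -> cond -> consistent U V I F 1 x t) ->
  (cond -> determines_xdot U V I F 1) -> ~ determines_xdot U V I F 0 ->
  (forall x t, consistent U V I F 1 x t -> ~ cond -> ~ determines_xdot U V I F 1) ->
  (exists x t, consistent U V I F 0 x t) ->
  differentiation_index U V I F 1 <-> cond.
Proof.
move=> con1 det1 ndet0 ndet1 [x [t con0]]; split.
  case=> [[x' [t' con]] det _]; apply: contrapT => nc; exact: ndet1 con nc det.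
move=> c; split; [by exists x, t; exact: con1|exact: det1|by case].
Qed.

(** A point consistent at order 2 is consistent at order 1, and there the failure of [cond] rules
    out uniqueness. *)
Lemma index2_intro (cond : Prop) : ~ cond ->
  (exists x t, consistent U V I F 2 x t) ->
  determines_xdot U V I F 2 -> ~ determines_xdot U V I F 0 ->
  (forall x t, consistent U V I F 1 x t -> ~ cond -> ~ determines_xdot U V I F 1) ->
  differentiation_index U V I F 2.
Proof.
move=> nc [x [t con2]] det2 ndet0 ndet1; split=> //; first by exists x, t.
case=> [|[|//]] _ //; apply: ndet1 (nc).
exact: (consistent_le _ con2).
Qed.

End IndexBasics.

(** * Index of the two circuit systems in terms of kernels *)

Section CircuitIndex.
Variables (R : realType) (G : circuit) (I : interval R).
Variables (qinv : 'cV[R]_(nC G) -> 'cV[R]_(nC G))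
  (phiinv : 'cV[R]_(nL G) -> 'cV[R]_(nL G))
  (g : 'cV[R]_(nR G) -> 'cV[R]_(nR G)).
Variables (isrc : R -> 'cV[R]_(nI G)) (vsrc : R -> 'cV[R]_(nV G)).
Variables (DC : 'cV[R]_(nC G) -> 'M[R]_(nC G)) (DL : 'cV[R]_(nL G) -> 'M[R]_(nL G))
  (Dg : 'cV[R]_(nR G) -> 'M[R]_(nR G)).

Local Notation A_C := (incidence G R Capacitance).
Local Notation A_R := (incidence G R Resistance).
Local Notation A_L := (incidence G R Inductance).
Local Notation A_V := (incidence G R VoltageSource).
Local Notation A_I := (incidence G R CurrentSource).
Local Notation L0 t :=
  (level0 A_C A_R A_L A_V qinv phiinv g (A_I *m isrc t) (vsrc t)).
Local Notation L1 t :=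
  (level1 A_C A_R A_L A_V DC DL Dg (A_I *m 'D_1 isrc t) ('D_1 vsrc t)).
Local Notation L2 t :=
  (level2 A_C A_R A_L A_V DC DL Dg (second_derivative DC) (second_derivative DL)
    (second_derivative Dg) (A_I *m 'D_1 ('D_1 isrc) t) ('D_1 ('D_1 vsrc) t)).

Hypotheses (dC : forall a b, is_derive a b qinv (DC a *m b))
  (dL : forall a b, is_derive a b phiinv (DL a *m b))
  (dg : forall a b, is_derive a b g (Dg a *m b)).
Hypotheses (defC : forall q, definite (DC q)) (defL : forall p, definite (DL p))
  (defg : forall x, definite (Dg x)).
Variable J : set R.
Hypotheses (Jopen : open J) (IJ : [set` I] `<=` J).
Hypotheses (di : forall s, J s -> differentiable isrc s)
  (dv : forall s, J s -> differentiable vsrc s).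

(** The regularity behind the closed form of the order 2 rows, kept apart because the index 1
    criterion is proved for [C^1] data. *)
Definition smooth_data : Prop :=
  [/\ twice_derivable DC, twice_derivable DL, twice_derivable Dg,
      forall s, J s -> differentiable ('D_1 isrc) s
    & forall s, J s -> differentiable ('D_1 vsrc) s].

Hypothesis AV_inj : forall w : 'cV_(nV G), A_V *m w = 0 -> w = 0.
Hypothesis CRLV_inj : forall u : 'cV_(n_node G), A_C^T *m u = 0 ->
  A_R^T *m u = 0 -> A_L^T *m u = 0 -> A_V^T *m u = 0 -> u = 0.
Hypothesis N_gt0 : (0 < n_node G)%N.

Definition LI_kernel : Prop := exists2 u : 'cV[R]_(n_node G), u != 0
  & [/\ A_C^T *m u = 0, A_R^T *m u = 0 & A_V^T *m u = 0].

Definition CV_mixed_kernel : Prop :=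
  exists (wc : 'cV[R]_(nC G)) (wv : 'cV[R]_(nV G)),
    A_C *m wc + A_V *m wv = 0 /\ wv != 0.

Definition CV_kernel : Prop :=
  exists (wc : 'cV[R]_(nC G)) (wv : 'cV[R]_(nV G)),
    A_C *m wc + A_V *m wv = 0 /\ ~ (wc = 0 /\ wv = 0).

Lemma LI_kernel_trivial : ~ LI_kernel -> forall u : 'cV_(n_node G),
  A_C^T *m u = 0 -> A_R^T *m u = 0 -> A_V^T *m u = 0 -> u = 0.
Proof.
move=> nli u Cu Ru Vu; apply/eqP; apply: contra_notT nli => u0; by exists u.
Qed.

Lemma CV_mixed_kernel_trivial : ~ CV_mixed_kernel ->
  forall (wc : 'cV_(nC G)) (wv : 'cV_(nV G)), A_C *m wc + A_V *m wv = 0 -> wv = 0.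
Proof.
move=> nk wc wv E; apply/eqP; apply: contra_notT nk => wv0; by exists wc, wv.
Qed.

Lemma CV_kernel_trivial : ~ CV_kernel ->
  forall (wc : 'cV_(nC G)) (wv : 'cV_(nV G)), A_C *m wc + A_V *m wv = 0 ->
  wc = 0 /\ wv = 0.
Proof. by move=> nk wc wv E; apply: contrapT => n0; apply: nk; exists wc, wv. Qed.

Lemma nonzero_potential : exists e : 'cV[R]_(n_node G), e != 0.
Proof.
exists (const_mx 1); apply/eqP => /matrixP/(_ (Ordinal N_gt0) 0).
by rewrite !mxE => /eqP; rewrite oner_eq0.
Qed.

Lemma addr_eq_self (T : zmodType) (a b : T) : a = a + b -> b = 0.
Proof. by move=> E; apply: (@addrI _ a); rewrite addr0 -E. Qed.

Lemma residuals_eq0 (A B C D : zmodType) (k : A) (p p' : B) (c c' : C) (v v' : D) :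
  [/\ k = 0, p - p' = 0, c - c' = 0 & v' - v = 0] <->
  [/\ k = 0, p = p', c = c' & v = v'].
Proof.
split=> -[-> pp cc vv]; last by rewrite pp cc vv !subrr.
by split=> //; apply/eqP; rewrite -subr_eq0 ?pp ?cc // -opprB vv oppr0.
Qed.

Let diI t : t \in I -> differentiable isrc t.
Proof. by move=> tI; apply/di/IJ. Qed.

Let dvI t : t \in I -> differentiable vsrc t.
Proof. by move=> tI; apply/dv/IJ. Qed.

Section Charge.
Local Notation F := (charge_DAE qinv phiinv g isrc vsrc).
Implicit Types (y : nat -> 'cV[R]_(charge_dim G)) (x xdot : 'cV[R]_(charge_dim G)).

Lemma charge_array0_eq0 y t : derivative_array F 0 y t = 0 <->
  L0 t (block1 (y 0)) (block1 (y 1)) (block2 (y 0)) (block2 (y 1)) (block3 (y 0))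
    (block4 (y 0)).
Proof.
rewrite /derivative_array /= charge_DAE_rows col4_eq0.
exact: residuals_eq0.
Qed.

Lemma charge_array1_eq0 y t : t \in I -> derivative_array F 1 y t = 0 <->
  L1 t (block1 (y 0)) (block1 (y 1)) (block1 (y 2)) (block2 (y 0)) (block2 (y 1))
    (block2 (y 2)) (block3 (y 0)) (block3 (y 1)) (block4 (y 1)).
Proof.
move=> tI; rewrite (charge_array1 dC dL dg _ (diI tI) (dvI tI)) col4_eq0.
exact: residuals_eq0.
Qed.

Lemma charge_array2_eq0 y t : smooth_data -> t \in I ->
  derivative_array F 2 y t = 0 <->
  L2 t (block1 (y 0)) (block1 (y 1)) (block1 (y 2)) (block1 (y 3)) (block2 (y 0))
    (block2 (y 1)) (block2 (y 2)) (block2 (y 3)) (block3 (y 0)) (block3 (y 1))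
    (block3 (y 2)) (block4 (y 2)).
Proof.
case=> ddC ddL ddg ddi ddv tI; have Jt := IJ tI.
rewrite (charge_array2 dC dL dg _ Jopen Jt di dv (ddi t Jt) (ddv t Jt) ddC ddL ddg).
rewrite col4_eq0.
exact: residuals_eq0.
Qed.

Lemma charge_solvable0 xdot x t : array_solvable setT F 0 xdot x t <->
  L0 t (block1 x) (block1 xdot) (block2 x) (block2 xdot) (block3 x) (block4 x).
Proof.
split=> [[_ [y [<- <- _ Fy]]]|l0]; first exact/charge_array0_eq0/Fy.
(* Row [j] of the array reads only the derivatives up to order [j.+1]; all later ones default to
   0. *)
split=> //; exists (nth 0 [:: x; xdot]); split=> // -[|//] _.
exact/charge_array0_eq0.
Qed.

Lemma charge_solvable1 xdot x t : t \in I -> array_solvable setT F 1 xdot x t <->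
  L0 t (block1 x) (block1 xdot) (block2 x) (block2 xdot) (block3 x) (block4 x) /\
  exists q2 p2, L1 t (block1 x) (block1 xdot) q2 (block2 x) (block2 xdot) p2
    (block3 x) (block3 xdot) (block4 xdot).
Proof.
move=> tI; split=> [[_ [y [<- <- _ Fy]]]|[l0 [q2 [p2 l1]]]].
  split; first exact/charge_array0_eq0/Fy.
  have /(charge_array1_eq0 _ tI) l1 := Fy 1%N isT.
  by exists (block1 (y 2)), (block2 (y 2)).
(* Second derivatives of potentials and source currents do not occur at order 1, so 0 will do. *)
split=> //; exists (nth 0 [:: x; xdot; col4 q2 p2 0 0]); split=> // -[|[|//]] _.
  exact/charge_array0_eq0.
apply/charge_array1_eq0 => //=.
by have [-> -> _ _] := @block_col4 R _ _ (n_node G) (nV G) q2 p2 0 0.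
Qed.

Lemma charge_solvable2 xdot x t : smooth_data -> t \in I ->
  array_solvable setT F 2 xdot x t <->
  L0 t (block1 x) (block1 xdot) (block2 x) (block2 xdot) (block3 x) (block4 x) /\
  exists q2 p2 q3 p3 e2 j2, L1 t (block1 x) (block1 xdot) q2 (block2 x)
      (block2 xdot) p2 (block3 x) (block3 xdot) (block4 xdot) /\
    L2 t (block1 x) (block1 xdot) q2 q3 (block2 x) (block2 xdot) p2 p3
      (block3 x) (block3 xdot) e2 j2.
Proof.
move=> sm tI; split=> [[_ [y [<- <- _ Fy]]]|[l0 [q2 [p2 [q3 [p3 [e2 [j2 [l1 l2]]]]]]]]].
  split; first exact/charge_array0_eq0/Fy.
  have /(charge_array1_eq0 _ tI) l1 := Fy 1%N isT.
  have /(charge_array2_eq0 _ sm tI) l2 := Fy 2%N isT.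
  by exists (block1 (y 2)), (block2 (y 2)), (block1 (y 3)), (block2 (y 3)),
    (block3 (y 2)), (block4 (y 2)).
split=> //; exists (nth 0 [:: x; xdot; col4 q2 p2 e2 j2; col4 q3 p3 0 0]).
have [E1 E2 E3 E4] := block_col4 q2 p2 e2 j2.
have [E1' E2' _ _] := @block_col4 R _ _ (n_node G) (nV G) q3 p3 0 0.
split=> // -[|[|[|//]]] _; first exact/charge_array0_eq0.
  by apply/charge_array1_eq0; rewrite //= E1 E2.
by apply/charge_array2_eq0; rewrite //= E1 E2 E3 E4 E1' E2'.
Qed.

(** The derivative of the potential does not occur at order 0, and there is at least one node to
    perturb. *)
Lemma charge_not_determined0 x t : consistent setT setT I F 0 x t ->
  ~ determines_xdot setT setT I F 0.
Proof.
move=> con; have [_ tI [xdot sol]] := con; have [u u0] := nonzero_potential.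
apply: (not_determines_of_two (xdot' := col4 (block1 xdot) (block2 xdot)
  (block3 xdot + u) (block4 xdot)) con sol).
  apply/charge_solvable0; have [-> -> _ _] := block_col4 (block1 xdot) (block2 xdot)
    (block3 xdot + u) (block4 xdot).
  exact/charge_solvable0.
move/(congr1 (@block3 _ _ _ _ _)).
have [_ _ -> _] := block_col4 (block1 xdot) (block2 xdot) (block3 xdot + u) (block4 xdot).
by move/addr_eq_self/eqP; apply/negP.
Qed.

(** [level1_shift] yields a second solution. Its [dq] part goes into the second derivative of the
    charges, outside [xdot]; a kernel vector of [A_C] and [A_V] therefore becomes visible only
    through a nonzero [wv]. *)
Lemma charge_not_determined1 x t : consistent setT setT I F 1 x t ->
  ~ (~ CV_mixed_kernel /\ ~ LI_kernel) -> ~ determines_xdot setT setT I F 1.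
Proof.
move=> con; have [_ tI [xdot sol]] := con.
have /(charge_solvable1 _ _ tI)[l0 [q2 [p2 l1]]] := sol.
have shift (dq : 'cV_(nC G)) (de : 'cV_(n_node G)) (dj : 'cV_(nV G)) :
    A_C *m dq + A_V *m dj = 0 ->
    A_C^T *m de = 0 -> A_R^T *m de = 0 -> A_V^T *m de = 0 -> ~ (de = 0 /\ dj = 0) ->
    ~ determines_xdot setT setT I F 1.
  move=> CVd Cd Rd Vd d0; pose xdot' : 'cV[R]_(charge_dim G) :=
    col4 (block1 xdot) (block2 xdot) (block3 xdot + de) (block4 xdot + dj).
  have [E1 E2 E3 E4] := block_col4 (block1 xdot) (block2 xdot)
    (block3 xdot + de) (block4 xdot + dj).
  apply: (not_determines_of_two (xdot' := xdot') con sol).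
    apply/(charge_solvable1 _ _ tI); rewrite E1 E2 E3 E4; split=> //.
    exists (q2 + dq), (p2 + A_L^T *m de); exact: level1_shift.
  move=> E; apply: d0; split.
    have := congr1 (@block3 _ _ _ _ _) E; rewrite E3.
    by move/addr_eq_self.
  have := congr1 (@block4 _ _ _ _ _) E; rewrite E4.
  by move/addr_eq_self.
move/not_andP => [/contrapT[wc [wv [E wv0]]]|/contrapT[u u0 [Cu Ru Vu]]].
  by apply: (shift wc 0 wv); rewrite ?mulmx0 // => -[_ /eqP]; apply/negP.
by apply: (shift 0 u 0); rewrite ?mulmx0 ?addr0 // => -[/eqP]; move/negP: u0.
Qed.

Lemma charge_index1 : (exists x t, consistent setT setT I F 0 x t) ->
  differentiation_index setT setT I F 1 <-> ~ CV_mixed_kernel /\ ~ LI_kernel.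
Proof.
move=> [x0 [t0 con0]]; apply: index1_iff => //; last by exists x0, t0.
- move=> x t [_ tI [xdot /charge_solvable0 l0]].
  case=> /CV_mixed_kernel_trivial CV /LI_kernel_trivial LI.
  have [q1 [q2 [p2 [e1 [j1 [_ l0' l1]]]]]] :=
    level1_exists DL (A_I *m 'D_1 isrc t) ('D_1 vsrc t) defC defg AV_inj LI CV l0.
  split=> //; exists (col4 q1 (block2 xdot) e1 j1).
  apply/(charge_solvable1 _ _ tI).
  have [-> -> -> ->] := block_col4 q1 (block2 xdot) e1 j1.
  by split=> //; exists q2, p2.
- case=> /CV_mixed_kernel_trivial CV /LI_kernel_trivial LI x t [_ tI [xdot sol]].
  exists xdot; split=> // xdot' /(charge_solvable1 _ _ tI)[l0' [q2' [p2' l1']]].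
  move: sol => /(charge_solvable1 _ _ tI)[l0 [q2 [p2 l1]]].
  have [Eq Ep CVd [Cd Rd Vd]] := level1_diff defC defg l0 l0' l1 l1'.
  apply: block_ext => //; apply/eqP; rewrite -subr_eq0; apply/eqP; first exact: LI.
  exact: CV CVd.
- exact: charge_not_determined0 con0.
- exact: charge_not_determined1.
Qed.

Lemma charge_index2 : smooth_data -> (exists x t, consistent setT setT I F 0 x t) ->
  ~ (~ CV_mixed_kernel /\ ~ LI_kernel) -> differentiation_index setT setT I F 2.
Proof.
move=> sm [x0 [t con0]] nc; have [_ tI [xdot /charge_solvable0 l0]] := con0.
apply: (index2_intro nc); last 2 first.
- exact: charge_not_determined0 con0.
- exact: charge_not_determined1.
- have [q1 [q2 [q3 [p1 [p2 [p3 [e0 [e1 [e2 [j0 [j1 [j2 [l0' l1 l2]]]]]]]]]]]]] :=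
    level2_exists (second_derivative DC) (second_derivative DL) (second_derivative Dg)
      (A_I *m 'D_1 isrc t) (A_I *m 'D_1 ('D_1 isrc) t) ('D_1 vsrc t)
      ('D_1 ('D_1 vsrc) t) defC defL defg AV_inj CRLV_inj l0.
  (* The consistent point keeps the charges and fluxes of [x0]; potentials and source currents are
     replaced. *)
  exists (col4 (block1 x0) (block2 x0) e0 j0), t; split=> //.
  exists (col4 q1 p1 e1 j1); apply/(charge_solvable2 _ _ sm tI).
  have [-> -> -> ->] := block_col4 (block1 x0) (block2 x0) e0 j0.
  have [-> -> -> ->] := block_col4 q1 p1 e1 j1.
  by split=> //; exists q2, p2, q3, p3, e2, j2.
- move=> x s [_ sI [zdot sol]]; exists zdot; split=> // zdot'.
  move=> /(charge_solvable2 _ _ sm sI)[m0' [q2' [p2' [q3' [p3' [e2' [j2' [m1' m2']]]]]]]].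
  move: sol => /(charge_solvable2 _ _ sm sI)[m0 [q2 [p2 [q3 [p3 [e2 [j2 [m1 m2]]]]]]]].
  have [Eq Ep Ee Ej _] :=
    level2_diff defC defL defg AV_inj CRLV_inj m0 m0' m1 m1' m2 m2'.
  exact: block_ext.
Qed.

End Charge.

Section Extended.
Local Notation F := (extended_DAE qinv phiinv g isrc vsrc).
Local Notation pot x := (usubmx x : 'cV[R]_(n_node G)).
Local Notation tailx x := (dsubmx x : 'cV[R]_(nC G + (nC G + (nL G + nV G)))).
Implicit Types (y : nat -> 'cV[R]_(extended_dim G)) (x xdot : 'cV[R]_(extended_dim G)).

Lemma extended_residuals_eq0 (A B C D E : zmodType) (k : A) (p p' : B) (c c' : C)
    (v v' : D) (q d : E) :
  (k = 0 /\ [/\ - (c - c') = 0, q - d = 0, p - p' = 0 & v' - v = 0]) <->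
  ([/\ k = 0, p = p', c = c' & v = v'] /\ q = d).
Proof.
rewrite -residuals_eq0; split=> [[-> [cc qd -> ->]]|[[-> -> -> ->] ->]].
  split; last by apply/eqP; rewrite -subr_eq0 qd.
  by split=> //; rewrite -[c - c']opprK cc oppr0.
by rewrite oppr0 subrr.
Qed.

(* The charging currents play the role of the first derivative of the charges. *)
Lemma extended_array0_eq0 y t : derivative_array F 0 y t = 0 <->
  L0 t (block2 (tailx (y 0))) (block1 (tailx (y 0))) (block3 (tailx (y 0)))
    (block3 (tailx (y 1))) (pot (y 0)) (block4 (tailx (y 0))) /\
  block2 (tailx (y 1)) = block1 (tailx (y 0)).
Proof.
rewrite /derivative_array /= extended_DAE_rows col5_eq0.
exact: extended_residuals_eq0.
Qed.

Lemma extended_array1_eq0 y t : t \in I -> derivative_array F 1 y t = 0 <->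
  L1 t (block2 (tailx (y 0))) (block2 (tailx (y 1))) (block1 (tailx (y 1)))
    (block3 (tailx (y 0))) (block3 (tailx (y 1))) (block3 (tailx (y 2)))
    (pot (y 0)) (pot (y 1)) (block4 (tailx (y 1))) /\
  block2 (tailx (y 2)) = block1 (tailx (y 1)).
Proof.
move=> tI; rewrite (extended_array1 dC dL dg _ (diI tI) (dvI tI)) col5_eq0.
exact: extended_residuals_eq0.
Qed.

Lemma extended_array2_eq0 y t : smooth_data -> t \in I ->
  derivative_array F 2 y t = 0 <->
  L2 t (block2 (tailx (y 0))) (block2 (tailx (y 1))) (block2 (tailx (y 2)))
    (block1 (tailx (y 2))) (block3 (tailx (y 0))) (block3 (tailx (y 1)))
    (block3 (tailx (y 2))) (block3 (tailx (y 3))) (pot (y 0)) (pot (y 1))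
    (pot (y 2)) (block4 (tailx (y 2))) /\
  block2 (tailx (y 3)) = block1 (tailx (y 2)).
Proof.
case=> ddC ddL ddg ddi ddv tI; have Jt := IJ tI.
rewrite (extended_array2 dC dL dg _ Jopen Jt di dv (ddi t Jt) (ddv t Jt) ddC ddL ddg).
rewrite col5_eq0; exact: extended_residuals_eq0.
Qed.

Lemma col5_split (e : 'cV[R]_(n_node G)) jc q p j (x := col5 e jc q p j) :
  pot x = e /\ [/\ block1 (tailx x) = jc, block2 (tailx x) = q,
    block3 (tailx x) = p & block4 (tailx x) = j].
Proof. by rewrite /x /col5 col_mxKu col_mxKd; split=> //; exact: block_col4. Qed.

Lemma extended_ext x x' : pot x = pot x' -> block1 (tailx x) = block1 (tailx x') ->
  block2 (tailx x) = block2 (tailx x') -> block3 (tailx x) = block3 (tailx x') ->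
  block4 (tailx x) = block4 (tailx x') -> x = x'.
Proof.
move=> E0 E1 E2 E3 E4; have E := block_ext E1 E2 E3 E4.
by rewrite -[LHS](@vsubmxK _ (n_node G)) E0 E vsubmxK.
Qed.

Lemma extended_solvable0 xdot x t : array_solvable setT F 0 xdot x t <->
  L0 t (block2 (tailx x)) (block1 (tailx x)) (block3 (tailx x)) (block3 (tailx xdot))
    (pot x) (block4 (tailx x)) /\
  block2 (tailx xdot) = block1 (tailx x).
Proof.
split=> [[_ [y [<- <- _ Fy]]]|l0]; first exact/extended_array0_eq0/Fy.
split=> //; exists (nth 0 [:: x; xdot]); split=> // -[|//] _.
exact/extended_array0_eq0.
Qed.

Lemma extended_solvable1 xdot x t : t \in I -> array_solvable setT F 1 xdot x t <->
  [/\ L0 t (block2 (tailx x)) (block1 (tailx x)) (block3 (tailx x))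
      (block3 (tailx xdot)) (pot x) (block4 (tailx x)),
      block2 (tailx xdot) = block1 (tailx x)
    & exists p2, L1 t (block2 (tailx x)) (block2 (tailx xdot)) (block1 (tailx xdot))
      (block3 (tailx x)) (block3 (tailx xdot)) p2 (pot x) (pot xdot)
      (block4 (tailx xdot))].
Proof.
move=> tI; split=> [[_ [y [<- <- _ Fy]]]|[l0 q1 [p2 l1]]].
  have /extended_array0_eq0[l0 q1] := Fy 0%N isT.
  have /(extended_array1_eq0 _ tI)[l1 _] := Fy 1%N isT.
  by split=> //; exists (block3 (tailx (y 2))).
pose x2 : 'cV[R]_(extended_dim G) := col5 0 0 (block1 (tailx xdot)) p2 0.
have [_ [_ E2 E3 _]] := @col5_split 0 0 (block1 (tailx xdot)) p2 0.
split=> //; exists (nth 0 [:: x; xdot; x2]); split=> // -[|[|//]] _.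
  exact/extended_array0_eq0.
by apply/extended_array1_eq0; rewrite //= E2 E3.
Qed.

Lemma extended_solvable2 xdot x t : smooth_data -> t \in I ->
  array_solvable setT F 2 xdot x t <->
  [/\ L0 t (block2 (tailx x)) (block1 (tailx x)) (block3 (tailx x))
      (block3 (tailx xdot)) (pot x) (block4 (tailx x)),
      block2 (tailx xdot) = block1 (tailx x)
    & exists p2 q3 p3 e2 j2, L1 t (block2 (tailx x)) (block2 (tailx xdot))
        (block1 (tailx xdot)) (block3 (tailx x)) (block3 (tailx xdot)) p2
        (pot x) (pot xdot) (block4 (tailx xdot)) /\
      L2 t (block2 (tailx x)) (block2 (tailx xdot)) (block1 (tailx xdot)) q3
        (block3 (tailx x)) (block3 (tailx xdot)) p2 p3 (pot x) (pot xdot) e2 j2].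
Proof.
move=> sm tI; split=> [[_ [y [<- <- _ Fy]]]|[l0 q1 [p2 [q3 [p3 [e2 [j2 [l1 l2]]]]]]]].
  have /extended_array0_eq0[l0 q1] := Fy 0%N isT.
  have /(extended_array1_eq0 _ tI)[l1 q2] := Fy 1%N isT.
  have /(extended_array2_eq0 _ sm tI)[l2 _] := Fy 2%N isT.
  rewrite q2 in l2; split=> //.
  by exists (block3 (tailx (y 2))), (block1 (tailx (y 2))), (block3 (tailx (y 3))),
    (pot (y 2)), (block4 (tailx (y 2))).
(* The relation between charges and charging currents is differentiated too: the second derivative
   of the charges is the derivative of [j_C], and their third derivative [q3] is the second
   derivative of [j_C]. *)
pose x2 : 'cV[R]_(extended_dim G) := col5 e2 q3 (block1 (tailx xdot)) p2 j2.
pose x3 : 'cV[R]_(extended_dim G) := col5 0 0 q3 p3 0.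
have [E0 [E1 E2 E3 E4]] := @col5_split e2 q3 (block1 (tailx xdot)) p2 j2.
have [_ [_ E2' E3' _]] := @col5_split 0 0 q3 p3 0.
split=> //; exists (nth 0 [:: x; xdot; x2; x3]); split=> // -[|[|[|//]]] _.
- exact/extended_array0_eq0.
- by apply/extended_array1_eq0; rewrite //= E2 E3.
- by apply/extended_array2_eq0; rewrite //= E0 E1 E2 E3 E4 E2' E3'.
Qed.

Lemma extended_not_determined0 x t : consistent setT setT I F 0 x t ->
  ~ determines_xdot setT setT I F 0.
Proof.
move=> con; have [_ tI [xdot sol]] := con; have [u u0] := nonzero_potential.
pose xdot' : 'cV[R]_(extended_dim G) := col5 (pot xdot + u) (block1 (tailx xdot))
  (block2 (tailx xdot)) (block3 (tailx xdot)) (block4 (tailx xdot)).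
have [E0 [E1 E2 E3 E4]] := @col5_split (pot xdot + u) (block1 (tailx xdot))
  (block2 (tailx xdot)) (block3 (tailx xdot)) (block4 (tailx xdot)).
apply: (not_determines_of_two (xdot' := xdot') con sol).
  by apply/extended_solvable0; rewrite E2 E3; exact/extended_solvable0.
move/(congr1 (fun z => pot z)); rewrite E0 => /addr_eq_self/eqP; exact/negP.
Qed.

(** Here [dq] shifts the derivative of [j_C], which belongs to [xdot]; so any nonzero kernel vector
    of [A_C] and [A_V] is visible, even one supported on capacitances alone. *)
Lemma extended_not_determined1 x t : consistent setT setT I F 1 x t ->
  ~ (~ CV_kernel /\ ~ LI_kernel) -> ~ determines_xdot setT setT I F 1.
Proof.
move=> con; have [_ tI [xdot sol]] := con.
have /(extended_solvable1 _ _ tI)[l0 q1 [p2 l1]] := sol.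
have shift (dq : 'cV_(nC G)) (de : 'cV_(n_node G)) (dj : 'cV_(nV G)) :
    A_C *m dq + A_V *m dj = 0 -> A_C^T *m de = 0 -> A_R^T *m de = 0 ->
    A_V^T *m de = 0 -> ~ [/\ dq = 0, de = 0 & dj = 0] ->
    ~ determines_xdot setT setT I F 1.
  move=> CVd Cd Rd Vd d0; pose xdot' : 'cV[R]_(extended_dim G) :=
    col5 (pot xdot + de) (block1 (tailx xdot) + dq) (block2 (tailx xdot))
      (block3 (tailx xdot)) (block4 (tailx xdot) + dj).
  have [E0 [E1 E2 E3 E4]] := @col5_split (pot xdot + de) (block1 (tailx xdot) + dq)
    (block2 (tailx xdot)) (block3 (tailx xdot)) (block4 (tailx xdot) + dj).
  apply: (not_determines_of_two (xdot' := xdot') con sol).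
    apply/(extended_solvable1 _ _ tI); rewrite E0 E1 E2 E3 E4; split=> //.
    exists (p2 + A_L^T *m de); exact: level1_shift.
  move=> E; apply: d0; split.
  - by have := congr1 (fun z => block1 (tailx z)) E; rewrite E1 => /addr_eq_self.
  - by have := congr1 (fun z => pot z) E; rewrite E0 => /addr_eq_self.
  - by have := congr1 (fun z => block4 (tailx z)) E; rewrite E4 => /addr_eq_self.
move/not_andP => [/contrapT[wc [wv [E w0]]]|/contrapT[u u0 [Cu Ru Vu]]].
  by apply: (shift wc 0 wv); rewrite ?mulmx0 // => -[wc0 _ wv0]; exact: w0.
by apply: (shift 0 u 0); rewrite ?mulmx0 ?addr0 // => -[_ /eqP]; move/negP: u0.
Qed.

Lemma extended_index1 : (exists x t, consistent setT setT I F 0 x t) ->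
  differentiation_index setT setT I F 1 <-> ~ CV_kernel /\ ~ LI_kernel.
Proof.
move=> [x0 [t0 con0]]; apply: index1_iff => //; last by exists x0, t0.
- move=> x t [_ tI [xdot /extended_solvable0[l0 q1]]].
  case=> /CV_kernel_trivial CV /LI_kernel_trivial LI.
  have [q1' [q2 [p2 [e1 [j1 [Eq l0' l1]]]]]] :=
    level1_exists DL (A_I *m 'D_1 isrc t) ('D_1 vsrc t) defC defg AV_inj LI
      (fun wc wv E => proj2 (CV wc wv E)) l0.
  (* [level1_exists] may change the charging currents, which are part of [x] in this system;
     injectivity of [A_C] shows that they did not move. *)
  have E1 : q1' = block1 (tailx x).
    apply/eqP; rewrite -subr_eq0; apply/eqP; apply: (proj1 (CV _ 0 _)).
    by rewrite mulmxBr Eq subrr add0r mulmx0.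
  split=> //; exists (col5 e1 q2 (block1 (tailx x)) (block3 (tailx xdot)) j1).
  apply/(extended_solvable1 _ _ tI).
  have [-> [-> -> -> ->]] :=
    @col5_split e1 q2 (block1 (tailx x)) (block3 (tailx xdot)) j1.
  by split=> //; exists p2; rewrite -E1.
- case=> /CV_kernel_trivial CV /LI_kernel_trivial LI x t [_ tI [xdot sol]].
  exists xdot; split=> // xdot' /(extended_solvable1 _ _ tI)[l0' q1' [p2' l1']].
  move: sol => /(extended_solvable1 _ _ tI)[l0 q1 [p2 l1]].
  (* Level 0 is stated with [j_C] and level 1 with the derivative of the charges; they are
     identified before comparing the solutions. *)
  rewrite -q1 in l0; rewrite -q1' in l0'.
  have Eq : block2 (tailx xdot) = block2 (tailx xdot') by rewrite q1 q1'.
  rewrite Eq in l0 l1 => //.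
  have [_ Ep CVd [Cd Rd Vd]] := level1_diff defC defg l0 l0' l1 l1'.
  have [Ed Ej] := CV _ _ CVd.
  by apply: extended_ext => //; apply/eqP; rewrite -subr_eq0; apply/eqP => //; exact: LI.
- exact: extended_not_determined0 con0.
- exact: extended_not_determined1.
Qed.

Lemma extended_index2 : smooth_data -> (exists x t, consistent setT setT I F 0 x t) ->
  ~ (~ CV_kernel /\ ~ LI_kernel) -> differentiation_index setT setT I F 2.
Proof.
move=> sm [x0 [t con0]] nc; have [_ tI [xdot /extended_solvable0[l0 _]]] := con0.
apply: (index2_intro nc); last 2 first.
- exact: extended_not_determined0 con0.
- exact: extended_not_determined1.
- have [q1 [q2 [q3 [p1 [p2 [p3 [e0 [e1 [e2 [j0 [j1 [j2 [l0' l1 l2]]]]]]]]]]]]] :=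
    level2_exists (second_derivative DC) (second_derivative DL) (second_derivative Dg)
      (A_I *m 'D_1 isrc t) (A_I *m 'D_1 ('D_1 isrc) t) ('D_1 vsrc t)
      ('D_1 ('D_1 vsrc) t) defC defL defg AV_inj CRLV_inj l0.
  (* The component [j_C] of the point is also replaced, by the corrected first derivative [q1] of
     the charges. *)
  exists (col5 e0 q1 (block2 (tailx x0)) (block3 (tailx x0)) j0), t; split=> //.
  exists (col5 e1 q2 q1 p1 j1); apply/(extended_solvable2 _ _ sm tI).
  have [-> [-> -> -> ->]] :=
    @col5_split e0 q1 (block2 (tailx x0)) (block3 (tailx x0)) j0.
  have [-> [-> -> -> ->]] := @col5_split e1 q2 q1 p1 j1.
  by split=> //; exists p2, q3, p3, e2, j2.
- move=> x s [_ sI [zdot sol]]; exists zdot; split=> // zdot'.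
  move=> /(extended_solvable2 _ _ sm sI)[m0' q1' [p2' [q3' [p3' [e2' [j2' [m1' m2']]]]]]].
  move: sol => /(extended_solvable2 _ _ sm sI)[m0 q1 [p2 [q3 [p3 [e2 [j2 [m1 m2]]]]]]].
  rewrite -q1 in m0; rewrite -q1' in m0'.
  have [Eq Ep Ee Ej Eq2] :=
    level2_diff defC defL defg AV_inj CRLV_inj m0 m0' m1 m1' m2 m2'.
  exact: extended_ext.
Qed.

End Extended.
End CircuitIndex.

(** * Consequences of passivity and soundness, and the theorem *)

Section PassiveData.
Variable R : realType.

Lemma posdef_definite n (M : 'M[R]_n) : posdef M -> definite M.
Proof.
move=> Mpd u uMu; apply/eqP; apply: contraT => /Mpd.
by rewrite uMu mxE ltxx.
Qed.

(** A scalar equals its transpose, so the forms of [M] and [M^T] vanish at the same vectors. *)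
Lemma posdef_sym_part_definite n (M : 'M[R]_n) : posdef (M + M^T) -> definite M.
Proof.
move=> Mpd u uMu; apply: (posdef_definite Mpd).
rewrite mulmxDr mulmxDl uMu add0r; apply: trmx_inj.
by rewrite !trmx_mul !trmxK mulmxA uMu trmx0.
Qed.

Lemma twice_derivable_jac n (f : 'cV[R]_n -> 'cV[R]_n) :
  Ck 2 setT f -> twice_derivable (jac f).
Proof.
case=> fd f2 a b v.
have -> : (fun x => jac f x *m v) = 'D_v f.
  by apply/funext => x; have [_ <-] := is_derive_jac v (fd x I).
by apply: diff_derivable; case: (f2 v) => + _; exact.
Qed.

(** An edge is not a loop, so one of its ends differs from the ground. *)
Lemma n_node_gt0 (G : circuit) : (0 < #|edge G|)%N -> (0 < n_node G)%N.
Proof.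
case/card_gt0P=> a _; apply/card_gt0P.
have [ig|ig] := eqVneq (init a) (ground G); last by exists (init a); rewrite !inE.
by exists (ter a); rewrite !inE -ig eq_sym; exact: loop_free.
Qed.

End PassiveData.

Theorem theorem19 (R : realType) (G : circuit) (I : interval R)
    (q qinv : 'cV[R]_(nC G) -> 'cV[R]_(nC G))
    (phi phiinv : 'cV[R]_(nL G) -> 'cV[R]_(nL G))
    (g : 'cV[R]_(nR G) -> 'cV[R]_(nR G))
    (isrc : R -> 'cV[R]_(nI G)) (vsrc : R -> 'cV[R]_(nV G))
    (Hsound : soundness G)
    (Hpass : passivity q phi g)
    (Hqinv : cancel q qinv) (Hphiinv : cancel phi phiinv)
    (Hi : Ck_interval 1 I isrc) (Hv : Ck_interval 1 I vsrc) :
  let smooth2 :=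
    [/\ Ck 2 setT q, Ck 2 setT phi, Ck 2 setT g, Ck_interval 2 I isrc
      & Ck_interval 2 I vsrc] in
  (let F := charge_DAE qinv phiinv g isrc vsrc in
   let index1_condition :=
     ~ has_CV_cycle_both_types G /\
     ~ has_cut_in G [:: Inductance; CurrentSource] in
   (exists x t, consistent setT setT I F 0 x t) ->
   (differentiation_index setT setT I F 1 <-> index1_condition) /\
   (smooth2 -> ~ index1_condition -> differentiation_index setT setT I F 2))
  /\
  (let F := extended_DAE qinv phiinv g isrc vsrc in
   let index1_condition :=
     ~ has_cycle_in G [:: Capacitance; VoltageSource] /\
     ~ has_cut_in G [:: Inductance; CurrentSource] in
   (exists x t, consistent setT setT I F 0 x t) ->
   (differentiation_index setT setT I F 1 <-> index1_condition) /\
   (smooth2 -> ~ index1_condition -> differentiation_index setT setT I F 2)).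
Proof.
move=> smooth2; have [E0 Gc noV noI] := Hsound.
have [Hq Hphi [Hg1 Hgpd]] := Hpass.
have gd x : differentiable g x by case: Hg1 => + _; exact.
(* The equations involve the inverses of [q] and [phi]; these are their Jacobians by the inverse
   function rule. *)
pose DC x := invmx (jac q (qinv x)); pose DL x := invmx (jac phi (phiinv x)).
have dC a b : is_derive a b qinv (DC a *m b) by exact: is_derive_passive_inverse.
have dL a b : is_derive a b phiinv (DL a *m b) by exact: is_derive_passive_inverse.
have dg a b : is_derive a b g (jac g a *m b) by exact: is_derive_jac.
have defC x : definite (DC x).
  by apply/definite_inv/posdef_definite; case: Hq => _ _ /(_ (qinv x))[].
have defL x : definite (DL x).
  by apply/definite_inv/posdef_definite; case: Hphi => _ _ /(_ (phiinv x))[].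
have defg x : definite (jac g x) by exact/posdef_sym_part_definite/Hgpd.
have AV_inj := voltage_incidence_inj (R := R) noV.
have CRLV_inj := no_I_cut_inj (R := R) Gc noI.
have N0 := n_node_gt0 E0.
have [J1 [J1o IJ1 [di _]]] := Hi; have [J2 [J2o IJ2 [dv _]]] := Hv.
pose J := J1 `&` J2; have Jo : open J by exact: openI.
have IJ : [set` I] `<=` J by move=> t tI; split; [exact: IJ1|exact: IJ2].
have diJ s : J s -> differentiable isrc s by case=> /di.
have dvJ s : J s -> differentiable vsrc s by case=> _ /dv.
(* The [C^2] sources come with their own neighbourhoods of [I], so the order 2 argument runs on a
   new set [J']. *)
have smooth : smooth2 -> exists J', [/\ open J', [set` I] `<=` J',
    forall s, J' s -> differentiable isrc s, forall s, J' s -> differentiable vsrc s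
  & smooth_data isrc vsrc DC DL (jac g) J'].
  case=> q2 phi2 g2 [K1 [K1o IK1 [di1 di2]]] [K2 [K2o IK2 [dv1 dv2]]].
  exists (K1 `&` K2); split.
  - exact: openI.
  - by move=> t tI; split; [exact: IK1|exact: IK2].
  - by move=> s [/di1].
  - by move=> s [_ /dv1].
  split=> [a b v|a b v||s [K1s _]|s [_ K2s]].
  - exact: derivable_passive_inverse2.
  - exact: derivable_passive_inverse2.
  - exact: twice_derivable_jac.
  - by case: (di2 1) => + _; exact.
  - by case: (dv2 1) => + _; exact.
have mixedP := CV_mixed_cycleP R noV; have cvP := CV_cycleP R G.
have cutP := LI_cutP R Gc.
split=> F cond con; rewrite /cond ?mixedP ?cvP cutP; split.
- exact: (charge_index1 dC dL dg defC defg IJ diJ dvJ AV_inj N0 con).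
- case/smooth=> J' [J'o IJ' di' dv' sm].
  exact: (charge_index2 dC dL dg defC defL defg J'o IJ' di' dv' AV_inj CRLV_inj N0 sm con).
- exact: (extended_index1 dC dL dg defC defg IJ diJ dvJ AV_inj N0 con).
- case/smooth=> J' [J'o IJ' di' dv' sm].
  exact: (extended_index2 dC dL dg defC defL defg J'o IJ' di' dv' AV_inj CRLV_inj N0 sm con).
Qed.
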